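(* If $\zeta$ and $\xi$ are two distinct (not necessarily primitive) fourth roots of unity in $K$, then the Yetter-Drinfel'd Hopf algebras $A_\zeta$ and $A_\xi$ (of the second, noncommutative family) are not isomorphic as Yetter-Drinfel'd Hopf algebras.
   Context: $K$ is an algebraically closed field of characteristic zero and $\iota\in K$ is a primitive fourth root of unity. A fourth root of unity is an element $\zeta\in K$ with $\zeta^4=1$. Let $G=\mathbb{Z}_2\times\mathbb{Z}_2$, written multiplicatively, with elements $g_1=(0,0)=1_G$, $g_2=(1,0)$, $g_3=(0,1)$, $g_4=(1,1)$, and let $H=K[G]$ be its group algebra. Yetter-Drinfel'd modules are left-left (left modules and left comodules); a Yetter-Drinfel'd Hopf algebra over $H$ is a Hopf algebra in the braided category of such modules, with braiding $a\otimes b\mapsto (a^{(1)}.b)\otimes a^{(2)}$, where $\delta(a)=a^{(1)}\otimes a^{(2)}$ denotes the coaction. An isomorphism of Yetter-Drinfel'd Hopf algebras is a bijective map that is an algebra and coalgebra homomorphism and is $H$-linear and $H$-colinear. For a fourth root of unity $\zeta$, let $A_\zeta$ be the (second-family) algebra generated by two noncommuting variables $x,y$ with defining relations $x^4=1$, $xy=yx^3$, $y^2=\frac12(\zeta1+x-\zeta x^2+x^3)$. It is a Yetter-Drinfel'd Hopf algebra over $H$ as follows: $G$ acts by algebra automorphisms with $g_2.x=x^3$, $g_2.y=x^3y$, $g_3.x=x$, $g_3.y=x^2y$; the coaction is $\delta(a)=\frac14\sum_{g,g'\in G}\theta(g,g')\,g\otimes g'.a$, where $\theta$ is the symmetric bicharacter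 of $G$ with $\theta(g_2,g_2)=\zeta^2$, $\theta(g_2,g_3)=\theta(g_3,g_2)=-1$, $\theta(g_3,g_3)=1$; and the coalgebra structure is the one for which the following basis elements are group-like: $\omega_1=1$, $\omega_2=\frac12(1+\iota\zeta^2)x+\frac12(1-\iota\zeta^2)x^3$, $\omega_3=\frac12(1-\iota\zeta^2)x+\frac12(1+\iota\zeta^2)x^3$, $\omega_4=x^2$, $\eta_1=y$, $\eta_2=x^3y$, $\eta_3=x^2y$, $\eta_4=xy$. *)

(* Defs.v *)
From HB Require Import structures.
From mathcomp Require Import all_boot all_order all_algebra all_fingroup all_field.
From mathcomp Require Import ssrZ ring.
From Stdlib Require ZArith.

Set Implicit Arguments.
Unset Strict Implicit.
Unset Printing Implicit Defensive.

Import GRing.Theory VectorInternalTheory.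
Local Open Scope ring_scope.

(* The tensor product of finite-dimensional spaces, as matrices of coordinates
   in the bases underlying the vectType structures: tens u v is the pure tensor
   u (x) v and tlift f is the linear map induced by a bilinear map f. *)
Section Tensor.
Variable K : fieldType.
Implicit Types U V W : vectType K.

Definition tensor U V : Type := 'M[K]_(dim U, dim V).

HB.instance Definition _ U V := Vector.on (tensor U V).

Definition tens U V (u : U) (v : V) : tensor U V := (v2r u)^T *m v2r v.

Definition tlift U V (W : lmodType K) (f : U -> V -> W) (t : tensor U V) : W :=
  \sum_i \sum_j
    (t : 'M_(_, _)) i j *: f (r2v (delta_mx 0 i)) (r2v (delta_mx 0 j)).

Definition tmap U V U' V' (f : U -> U') (g : V -> V') :
    tensor U V -> tensor U' V' :=
  tlift (fun u v => tens (f u) (g v)).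

Definition tassoc U V W : tensor (tensor U V) W -> tensor U (tensor V W) :=
  tlift (fun t w => tlift (fun u v => tens u (tens v w)) t).

Lemma tens_linearl U V (v : V) : linear (fun u : U => tens u v).
Proof.
by move=> c u u'; rewrite /tens linearP !linearD !linearZ mulmxDl scalemxAl.
Qed.

Lemma tens_linearr U V (u : U) : linear (fun v : V => tens u v).
Proof. by move=> c v v'; rewrite /tens linearP mulmxDr scalemxAr. Qed.

Lemma tlift_linear U V (W : lmodType K) (f : U -> V -> W) : linear (tlift f).
Proof.
move=> c s t; rewrite /tlift scaler_sumr -big_split; apply: eq_bigr => i _ /=.
rewrite scaler_sumr -big_split; apply: eq_bigr => j _ /=.
by rewrite !mxE scalerDl scalerA.
Qed.

Lemma tlift_tens U V (W : lmodType K) (f : U -> V -> W) (u : U) (v : V) :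
  (forall v, linear (f^~ v)) -> (forall u, linear (f u)) ->
  tlift f (tens u v) = f u v.
Proof.
move=> fl fr.
pose FL v := GRing.isLinear.Build K U W _ (f^~ v) (fl v).
pose GL v : {linear U -> W} := HB.pack (f^~ v) (FL v).
pose FR u := GRing.isLinear.Build K V W _ (f u) (fr u).
pose GR u : {linear V -> W} := HB.pack (f u) (FR u).
transitivity (GL v (r2v (v2r u))); last by rewrite /= v2rK.
rewrite (row_sum_delta (v2r u)) !linear_sum; apply: eq_bigr => i _.
rewrite !linearZ /=; set ui := r2v (delta_mx 0 i).
transitivity (v2r u 0 i *: GR ui (r2v (v2r v))); last by rewrite /= v2rK.
rewrite (row_sum_delta (v2r v)) !linear_sum.
apply: eq_bigr => j _; rewrite !linearZ /= scalerA.
by rewrite /tens !mxE big_ord1 !mxE mulrC.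
Qed.

End Tensor.

(* Left-left Yetter-Drinfel'd Hopf algebras over the group algebra K[gT].
   - A left K[gT]-module structure is a linear action of gT.
   - K[gT] (x) A is identified with {ffun gT -> A}, so that
     delta(a) = \sum_g g (x) coact a g; a left comodule structure is a
     coassociative and counital map delta.
   The remaining axioms are those of a Hopf algebra in the category of
   Yetter-Drinfel'd modules, with braiding
     a (x) b |-> \sum_g (g.b) (x) coact a g. *)
Section YetterDrinfeld.
Variables (K : fieldType) (gT : finGroupType).

Section Operations.
Variables (A : falgType K) (act : gT -> A -> A) (coact : A -> {ffun gT -> A}).

(* The product of the braided tensor product algebra:
   (a (x) b)(c (x) d) = \sum_g a (g.c) (x) (coact b g) d. *)
Definition braided_mul (s t : tensor A A) : tensor A A :=
  tlift (fun a b => tlift (fun c d =>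
    \sum_g tens (a * act g c) (coact b g * d)) t) s.

(* The codiagonal coaction on A (x) A. *)
Definition tensor_coact (t : tensor A A) : {ffun gT -> tensor A A} :=
  tlift (fun a b : A =>
    [ffun g => \sum_h tens (coact a h) (coact b (h^-1 * g)%g)]) t.

End Operations.

Record ydHopf := YDHopf {
  carrier :> falgType K;
  act : gT -> {linear carrier -> carrier};
  coact : {linear carrier -> {ffun gT -> carrier}};
  comul : {linear carrier -> tensor carrier carrier};
  counit : {linear carrier -> K^o};
  antipode : {linear carrier -> carrier};
  act1 : forall a, act 1%g a = a;
  actM : forall g h a, act (g * h)%g a = act g (act h a);
  coact_coassoc :
    forall a g h, coact (coact a g) h = if g == h then coact a g else 0;
  coact_counit : forall a, \sum_g coact a g = a;
  coact_act : forall g h a, coact (act g a) (g * h * g^-1)%g = act g (coact a h);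
  act_unit : forall g, act g 1 = 1;
  act_mul : forall g a b, act g (a * b) = act g a * act g b;
  coact_unit : forall g, coact 1 g = if g == 1%g then 1 else 0;
  coact_mul :
    forall a b g, coact (a * b) g = \sum_h coact a h * coact b (h^-1 * g)%g;
  comul_coassoc :
    forall a, tassoc (tmap comul id (comul a)) = tmap id comul (comul a);
  comul_counitl : forall a, tlift (fun b c => counit b *: c) (comul a) = a;
  comul_counitr : forall a, tlift (fun b c => counit c *: b) (comul a) = a;
  comul_act : forall g a, comul (act g a) = tmap (act g) (act g) (comul a);
  comul_coact : forall a g, tensor_coact coact (comul a) g = comul (coact a g);
  counit_act : forall g a, counit (act g a) = counit a;
  counit_coact :
    forall a g, counit (coact a g) = if g == 1%g then counit a else 0;
  comul_unit : comul 1 = tens 1 1;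
  comul_mul : forall a b, comul (a * b) =
    braided_mul (fun g => act g) coact (comul a) (comul b);
  counit_unit : counit 1 = 1;
  counit_mul : forall a b, counit (a * b) = counit a * counit b;
  antipodel : forall a, tlift (fun b c => antipode b * c) (comul a) = counit a *: 1;
  antipoder : forall a, tlift (fun b c => b * antipode c) (comul a) = counit a *: 1;
  antipode_act : forall g a, antipode (act g a) = act g (antipode a);
  antipode_coact : forall a g, coact (antipode a) g = antipode (coact a g)
}.

Arguments act {_} _.
Arguments coact {_}.
Arguments comul {_}.
Arguments counit {_}.
Arguments antipode {_}.

Definition grouplike (A : ydHopf) (a : A) : Prop :=
  comul a = tens a a /\ counit a = 1.

Definition ydHopf_isomorphic (A B : ydHopf) : Prop :=
  exists f : {lrmorphism A -> B},
    [/\ bijective f,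
        forall a, comul (f a) = tmap f f (comul a),
        forall a, counit (f a) = counit a,
        forall g a, f (act g a) = act g (f a)
      & forall a g, coact (f a) g = f (coact a g)].

End YetterDrinfeld.

Arguments act {K gT _} _.
Arguments coact {K gT _}.
Arguments comul {K gT _}.
Arguments counit {K gT _}.
Arguments antipode {K gT _}.

(* The group Z_2 x Z_2; its product %g is the addition of pairs. *)
Definition G : finGroupType := ('Z_2 * 'Z_2)%type.

Definition g2 : G := (1%R, 0%R).
Definition g3 : G := (0%R, 1%R).

Section SecondFamily.
Variables (K : fieldType) (iota zeta : K).

(* theta is the bicharacter with theta g2 g2 = zeta ^+ 2,
   theta g2 g3 = theta g3 g2 = -1 and theta g3 g3 = 1; see theta_bichar and
   theta_gen below. *)
Definition theta (g h : G) : K :=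
  (zeta ^+ 2) ^+ (nat_of_ord g.1 * nat_of_ord h.1)
  * (-1) ^+ (nat_of_ord g.1 * nat_of_ord h.2 + nat_of_ord g.2 * nat_of_ord h.1).

Definition relations (B : algType K) (x y : B) : Prop :=
  [/\ x ^+ 4 = 1, x * y = y * x ^+ 3
    & y ^+ 2 = 2^-1 *: (zeta *: 1 + x - zeta *: x ^+ 2 + x ^+ 3)].

(* A is the algebra generated by x and y subject to the relations, expressed by
   the universal property of K<x, y> / (relations). *)
Definition presented_by (A : algType K) (x y : A) : Prop :=
  relations x y /\
  forall (B : algType K) (x' y' : B), relations x' y' ->
    exists f : {lrmorphism A -> B},
      [/\ f x = x', f y = y'
        & forall f' : {lrmorphism A -> B}, f' x = x' -> f' y = y' -> f' =1 f].

Definition omega2 (A : algType K) (x : A) : A :=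
  (2^-1 * (1 + iota * zeta ^+ 2)) *: x + (2^-1 * (1 - iota * zeta ^+ 2)) *: x ^+ 3.
Definition omega3 (A : algType K) (x : A) : A :=
  (2^-1 * (1 - iota * zeta ^+ 2)) *: x + (2^-1 * (1 + iota * zeta ^+ 2)) *: x ^+ 3.

Definition second_family_gen (A : ydHopf K G) (x y : A) : Prop :=
  [/\ presented_by x y,
      [/\ act g2 x = x ^+ 3, act g2 y = x ^+ 3 * y,
          act g3 x = x & act g3 y = x ^+ 2 * y],
      forall (a : A) g, coact a g = 4^-1 *: \sum_h theta g h *: act h a
    & {in [:: 1; omega2 x; omega3 x; x ^+ 2;
              y; x ^+ 3 * y; x ^+ 2 * y; x * y], forall a : A, grouplike a}].

(* A is (a copy of) the Yetter-Drinfel'd Hopf algebra A_zeta; its existence is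
   second_family_exists below. *)
Definition second_family (A : ydHopf K G) : Prop :=
  exists x y : A, second_family_gen x y.

End SecondFamily.

Lemma theta_gen (K : fieldType) (zeta : K) :
  [/\ theta zeta g2 g2 = zeta ^+ 2, theta zeta g2 g3 = -1,
      theta zeta g3 g2 = -1 & theta zeta g3 g3 = 1].
Proof. by rewrite /theta /= !expr0 !expr1 !mulr1 !mul1r. Qed.

Lemma theta_sym (K : fieldType) (zeta : K) g h : theta zeta g h = theta zeta h g.
Proof.
rewrite /theta; congr (_ ^+ _ * _ ^+ _); first exact: mulnC.
by rewrite addnC; congr (_ + _)%N; exact: mulnC.
Qed.

Lemma theta_bichar (K : fieldType) (zeta : K) : zeta ^+ 4 = 1 ->
  forall g g' h, theta zeta (g * g')%g h = theta zeta g h * theta zeta g' h.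
Proof.
move=> zeta4 g g' h; rewrite /theta mulrACA -!exprD addnACA -!mulnDl.
have z2 : (zeta ^+ 2) ^+ 2 = 1 by rewrite -exprM.
have m1 : (-1) ^+ 2 = 1 :> K by rewrite sqrrN expr1n.
have e (c : K) m n : c ^+ 2 = 1 -> m = n %[mod 2] -> c ^+ m = c ^+ n.
  by move=> c2 E; rewrite -(expr_mod m c2) E expr_mod.
congr (_ * _); apply: e => //; first by rewrite /= modnMml.
by rewrite -modnDm !modnMml modnDm.
Qed.

(* Existence of A_zeta.  The model is K^8 in the basis x^i y^j (at index
   i + 4 j); as zeta is a power of iota, all structure constants lie in
   Z[iota, 1/2], and the axioms are checked by computing there. *)
Module Model.

(* (a, b, e) stands for (a + b iota) / 2^e. *)
Definition dyad := (BinInt.Z * BinInt.Z * nat)%type.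
Definition zpow2 (e : nat) : BinInt.Z := iter e (BinInt.Z.mul 2) 1.
Definition d0 : dyad := (BinInt.Z0, BinInt.Z0, 0%N).
Definition d1 : dyad := (1, BinInt.Z0, 0%N).
Definition di : dyad := (BinInt.Z0, 1, 0%N).
Definition dhalf : dyad := (1, BinInt.Z0, 1%N).
Definition dopp (x : dyad) : dyad :=
  let: (a, b, e) := x in (BinInt.Z.opp a, BinInt.Z.opp b, e).
Definition dadd (x y : dyad) : dyad :=
  let: (a, b, e) := x in let: (a', b', e') := y in
  let p := zpow2 (e' - e) in let p' := zpow2 (e - e') in
  (BinInt.Z.add (BinInt.Z.mul a p) (BinInt.Z.mul a' p'),
   BinInt.Z.add (BinInt.Z.mul b p) (BinInt.Z.mul b' p'), e + (e' - e))%N.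
Definition dmul (x y : dyad) : dyad :=
  let: (a, b, e) := x in let: (a', b', e') := y in
  (BinInt.Z.sub (BinInt.Z.mul a a') (BinInt.Z.mul b b'),
   BinInt.Z.add (BinInt.Z.mul a b') (BinInt.Z.mul b a'), e + e')%N.
Definition deq (x y : dyad) : bool :=
  let: (a, b, e) := x in let: (a', b', e') := y in
  BinInt.Z.eqb (BinInt.Z.mul a (zpow2 e')) (BinInt.Z.mul a' (zpow2 e)) &&
  BinInt.Z.eqb (BinInt.Z.mul b (zpow2 e')) (BinInt.Z.mul b' (zpow2 e)).
Definition dexp (x : dyad) n := iter n (dmul x) d1.
Definition dsum (s : seq dyad) : dyad := foldr dadd d0 s.

(* Elements of K^8 and of K^8 (x) K^8 as sparse lists of coefficients. *)
Definition vec := seq (nat * dyad).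
Definition ten := seq (nat * nat * dyad).
Definition I8 := iota 0 8.
Definition vcoef (v : vec) i := dsum [seq p.2 | p <- v & p.1 == i].
Definition tcoef (t : ten) i j := dsum [seq p.2 | p <- t & p.1 == (i, j)].
Definition veq (u v : vec) := all (fun i => deq (vcoef u i) (vcoef v i)) I8.
Definition teq (s t : ten) :=
  all (fun i => all (fun j => deq (tcoef s i j) (tcoef t i j)) I8) I8.
Definition vE i : vec := [:: (i, d1)].
Definition vscale (c : dyad) (v : vec) : vec := [seq (p.1, dmul c p.2) | p <- v].
Definition tscale (c : dyad) (t : ten) : ten := [seq (p.1, dmul c p.2) | p <- t].
Definition vlin (T : nat -> vec) (v : vec) : vec :=
  flatten [seq vscale p.2 (T p.1) | p <- v & (p.1 < 8)%N].
Definition vlint (T : nat -> ten) (v : vec) : ten :=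
  flatten [seq tscale p.2 (T p.1) | p <- v & (p.1 < 8)%N].
Definition touter (u v : vec) : ten :=
  [seq ((p.1, q.1), dmul p.2 q.2) | p <- u, q <- v].

Section Tables.
Variable k : nat. (* zeta = iota ^+ k *)
Definition dz := dexp di k.
Definition dz2 := dmul dz dz.

(* coefficients of y^2, resp. y^-2, on 1, x, x^2, x^3 *)
Definition uT (n : nat) : dyad :=
  dmul dhalf (nth d0 [:: dz; d1; dopp dz; d1] (n %% 4)).
Definition uinvT (n : nat) : dyad :=
  let z' := dexp dz 3 in dmul dhalf (nth d0 [:: z'; d1; dopp z'; d1] (n %% 4)).

(* x^i y^a x^j y^b *)
Definition mulT (m n : nat) : vec :=
  let i := (m %% 4)%N in let a := (m %/ 4)%N in
  let j := (n %% 4)%N in let b := (n %/ 4)%N in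
  let e := (if a == 0 then i + j else i + 3 * j)%N in
  if (a + b == 2)%N then [seq ((e + l) %% 4, uT l)%N | l <- iota 0 4]
  else [:: ((e %% 4 + 4 * (a + b))%N, d1)].

Definition actT (p q n : nat) : vec :=
  let i := (n %% 4)%N in let a := (n %/ 4)%N in
  let e := ((if p == 0 then i else 3 * i + 3 * a) + 2 * q * a)%N in
  [:: ((e %% 4 + 4 * a)%N, d1)].

Definition thetaT (p q p' q' : nat) : dyad :=
  dmul (dexp dz2 (p * p')) (dexp (dopp d1) (p * q' + q * p')).

Definition coactT p q n : vec :=
  let F p' q' := vscale (dmul (dmul dhalf dhalf) (thetaT p q p' q')) (actT p' q' n) in
  (F 0 0 ++ F 0 1 ++ F 1 0 ++ F 1 1)%N.

Definition antT (n : nat) : vec :=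
  if (n < 4)%N then [:: (n, d1)]
  else [seq ((n + l) %% 4 + 4, uinvT l)%N | l <- iota 0 4].

(* glT i is the i-th group-like element, cT n lists the coordinates of the
   n-th monomial in the basis of group-like elements *)
Definition wp : dyad := dmul dhalf (dadd d1 (dmul di dz2)).
Definition wm : dyad := dmul dhalf (dadd d1 (dopp (dmul di dz2))).
Definition glT (i : nat) : vec :=
  if (i == 1)%N then [:: (1%N, wp); (3, wm)]
  else if (i == 3)%N then [:: (1%N, wm); (3, wp)] else vE i.
Definition cT (n : nat) : vec :=
  if (n == 1)%N then [:: (1%N, wm); (3, wp)]
  else if (n == 3)%N then [:: (1%N, wp); (3, wm)] else vE n.
Definition comulT (n : nat) : ten :=
  flatten [seq tscale p.2 (touter (glT p.1) (glT p.1)) | p <- cT n].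

Definition vmul (u v : vec) : vec := vlin (fun m => vlin (mulT m) v) u.
Definition vact p q := vlin (actT p q).
Definition vcoact p q := vlin (coactT p q).
Definition vant := vlin antT.
Definition vcomul := vlint comulT.
Definition veps (v : vec) : dyad := dsum [seq p.2 | p <- v & (p.1 < 8)%N].

Definition G4 := [:: (0, 0); (0, 1); (1, 0); (1, 1)]%N.
Definition allI (P : nat -> bool) := all P I8.
Definition allG (P : nat -> nat -> bool) := all (fun g => P g.1 g.2) G4.
Definition add2 (p q : nat) := ((p + q) %% 2)%N.

Definition chk_assoc := allI (fun i => allI (fun j => allI (fun l =>
  veq (vmul (vmul (vE i) (vE j)) (vE l)) (vmul (vE i) (vmul (vE j) (vE l)))))).
Definition chk_1 := allI (fun i =>
  veq (vmul (vE 0) (vE i)) (vE i) && veq (vmul (vE i) (vE 0)) (vE i)).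
Definition chk_act1 := allI (fun i => veq (vact 0 0 (vE i)) (vE i)).
Definition chk_actM := allG (fun p q => allG (fun p' q' => allI (fun i =>
  veq (vact (add2 p p') (add2 q q') (vE i)) (vact p q (vact p' q' (vE i)))))).
Definition chk_coassoc := allG (fun p q => allG (fun p' q' => allI (fun i =>
  veq (vcoact p' q' (vcoact p q (vE i)))
    (if (p == p') && (q == q') then vcoact p q (vE i) else [::])))).
Definition chk_coactsum := allI (fun i =>
  veq (vcoact 0 0 (vE i) ++ vcoact 0 1 (vE i) ++
       vcoact 1 0 (vE i) ++ vcoact 1 1 (vE i)) (vE i)).
Definition chk_coactact := allG (fun p q => allG (fun p' q' => allI (fun i =>
  veq (vcoact p' q' (vact p q (vE i))) (vact p q (vcoact p' q' (vE i)))))).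
Definition chk_actunit := allG (fun p q => veq (vact p q (vE 0)) (vE 0)).
Definition chk_actmul := allG (fun p q => allI (fun i => allI (fun j =>
  veq (vact p q (vmul (vE i) (vE j))) (vmul (vact p q (vE i)) (vact p q (vE j)))))).
Definition chk_coactunit := allG (fun p q =>
  veq (vcoact p q (vE 0)) (if (p == 0%N) && (q == 0%N) then vE 0 else [::])).
Definition chk_coactmul := allG (fun p q => allI (fun i => allI (fun j =>
  let F p' q' := vmul (vcoact p' q' (vE i)) (vcoact (add2 p' p) (add2 q' q) (vE j)) in
  veq (vcoact p q (vmul (vE i) (vE j)))
    (F 0 0 ++ F 0 1 ++ F 1 0 ++ F 1 1)%N))).
Definition chk_span := allI (fun n =>
  veq (vE n) (vlin glT (cT n))).
Definition chk_comulgl := allI (fun i => teq (vcomul (glT i)) (touter (glT i) (glT i))).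
Definition chk_comulact := allG (fun p q => allI (fun i =>
  teq (vcomul (vact p q (glT i))) (touter (vact p q (glT i)) (vact p q (glT i))))).
Definition chk_comulcoact := allG (fun p q => allI (fun i =>
  let F p' q' := touter (vcoact p' q' (glT i)) (vcoact (add2 p' p) (add2 q' q) (glT i)) in
  teq (F 0 0 ++ F 0 1 ++ F 1 0 ++ F 1 1)%N
    (vcomul (vcoact p q (glT i))))).
Definition chk_epsgl := allI (fun i => deq (veps (glT i)) d1).
Definition chk_epsact := allG (fun p q => allI (fun i =>
  deq (veps (vact p q (vE i))) (veps (vE i)))).
Definition chk_epscoact := allG (fun p q => allI (fun i =>
  deq (veps (vcoact p q (vE i)))
    (if (p == 0%N) && (q == 0%N) then veps (vE i) else d0))).
Definition chk_comulmul := allI (fun i => allI (fun j =>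
  let F p q := touter (vmul (glT i) (vact p q (glT j))) (vmul (vcoact p q (glT i)) (glT j)) in
  teq (vcomul (vmul (glT i) (glT j)))
   (F 0 0 ++ F 0 1 ++ F 1 0 ++ F 1 1)%N)).
Definition chk_epsmul := allI (fun i => allI (fun j =>
  deq (veps (vmul (vE i) (vE j))) d1)).
Definition chk_ant := allI (fun i =>
  veq (vmul (vant (glT i)) (glT i)) (vE 0) && veq (vmul (glT i) (vant (glT i))) (vE 0)).
Definition chk_antact := allG (fun p q => allI (fun i =>
  veq (vant (vact p q (vE i))) (vact p q (vant (vE i))))).
Definition chk_antcoact := allG (fun p q => allI (fun i =>
  veq (vcoact p q (vant (vE i))) (vant (vcoact p q (vE i))))).
End Tables.
Lemma allI_P (P : nat -> bool) : allI P -> forall i, (i < 8)%N -> P i.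
Proof. by move=> /allP h i lti; apply: h; rewrite mem_iota. Qed.

Lemma G_case (P : G -> Prop) :
  P (0, 0) -> P (0, 1) -> P (1, 0) -> P (1, 1) -> forall g, P g.
Proof.
move=> h00 h01 h10 h11 [[[|[|//]] p] [[|[|//]] q]];
  [move: h00 | move: h01 | move: h10 | move: h11];
  by congr P; congr pair; apply: val_inj.
Qed.

Lemma allG_P (P : nat -> nat -> bool) :
  allG P -> forall g : G, P (nat_of_ord g.1) (nat_of_ord g.2).
Proof. by case/and5P=> h00 h01 h10 h11 _; apply: G_case. Qed.

Lemma sumG (V : nmodType) (F : G -> V) :
  \sum_g F g = F (0, 0) + F (0, 1) + F (1, 0) + F (1, 1).
Proof.
rewrite (eq_bigr (fun g => F (g.1, g.2))) => [|[] //].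
rewrite -(pair_bigA _ (fun p q => F (p, q))) /=.
rewrite !big_ord_recl !big_ord0 !addr0 !addrA.
by congr (_ + _ + _ + _); congr (F (_, _)); apply: val_inj.
Qed.

Lemma nat1G (g h : G) : nat_of_ord (g * h)%g.1 = add2 g.1 h.1.
Proof. by []. Qed.
Lemma nat2G (g h : G) : nat_of_ord (g * h)%g.2 = add2 g.2 h.2.
Proof. by []. Qed.
Lemma invG (g : G) : (g^-1)%g = g.
Proof. by move: g; apply: G_case; congr pair; apply: val_inj. Qed.
Lemma eqG (g h : G) :
  (g == h) = (nat_of_ord g.1 == nat_of_ord h.1) && (nat_of_ord g.2 == nat_of_ord h.2).
Proof. by case: g h => [g g'] [h h']. Qed.
Lemma eqG1 (g : G) :
  (g == 1%g) = (nat_of_ord g.1 == 0%N) && (nat_of_ord g.2 == 0%N).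
Proof. exact: eqG. Qed.

Section Interpretation.
Variables (K : fieldType) (iota : K).
Hypotheses (two_neq0 : 2 != 0 :> K) (iota2 : iota ^+ 2 = -1).

Definition zK (z : BinInt.Z) : K := (int_of_Z z)%:~R.
Definition phi (x : dyad) : K :=
  let: (a, b, e) := x in (zK a + zK b * iota) * 2^-1 ^+ e.

Lemma zKD a b : zK (BinInt.Z.add a b) = zK a + zK b.
Proof. by rewrite /zK -rmorphD -[in RHS](rmorphD int_of_Z). Qed.
Lemma zKM a b : zK (BinInt.Z.mul a b) = zK a * zK b.
Proof. by rewrite /zK -rmorphM -[in RHS](rmorphM int_of_Z). Qed.
Lemma zKN a : zK (BinInt.Z.opp a) = - zK a.
Proof. by rewrite /zK -rmorphN -[in RHS](rmorphN int_of_Z). Qed.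
Lemma zKB a b : zK (BinInt.Z.sub a b) = zK a - zK b.
Proof. by rewrite /BinInt.Z.sub zKD zKN. Qed.
Lemma zK_pow2 e : zK (zpow2 e) = 2 ^+ e.
Proof. by elim: e => [|e IH] //; rewrite /zpow2 iterS zKM exprS -IH. Qed.

Lemma half_pow e f : 2 ^+ f * 2^-1 ^+ (e + f) = 2^-1 ^+ e :> K.
Proof. by rewrite exprD mulrCA -exprMn divff // expr1n mulr1. Qed.

Lemma phiD x y : phi (dadd x y) = phi x + phi y.
Proof.
case: x y => [[a b] e] [[a' b'] e'] /=.
have E : (e + (e' - e) = e' + (e - e'))%N by rewrite -!maxnE maxnC.
have H1 := half_pow e (e' - e); have H2 := half_pow e' (e - e').
by rewrite -{}E in H2; rewrite !zKD !zKM !zK_pow2 -H1 -H2; ring.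
Qed.

Lemma phiM x y : phi (dmul x y) = phi x * phi y.
Proof.
case: x y => [[a b] e] [[a' b'] e'] /=.
by rewrite zKB zKD !zKM exprD; ring: iota2.
Qed.

Lemma phiN x : phi (dopp x) = - phi x.
Proof. by case: x => [[a b] e] /=; rewrite !zKN; ring. Qed.

Lemma phi0 : phi d0 = 0.
Proof. by rewrite /= /zK (_ : int_of_Z _ = 0) // !mul0r addr0 mul0r. Qed.
Lemma phi1 : phi d1 = 1.
Proof.
by rewrite /= /zK (_ : int_of_Z _ = 1) // (_ : int_of_Z _ = 0) // mul0r addr0 mulr1.
Qed.
Lemma phi_i : phi di = iota.
Proof.
by rewrite /= /zK (_ : int_of_Z _ = 0) // (_ : int_of_Z _ = 1) // mul1r add0r mulr1.
Qed.
Lemma phi_half : phi dhalf = 2^-1.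
Proof.
by rewrite /= /zK (_ : int_of_Z _ = 1) // (_ : int_of_Z _ = 0) // mul0r addr0 mul1r.
Qed.

Lemma phiX x n : phi (dexp x n) = phi x ^+ n.
Proof. by elim: n => [|n IH]; rewrite ?phi1 // exprS -IH -phiM. Qed.

Lemma deqP x y : deq x y -> phi x = phi y.
Proof.
case: x y => [[a b] e] [[a' b'] e'] /andP[].
move=> /BinInt.Z.eqb_eq/(congr1 zK) + /BinInt.Z.eqb_eq/(congr1 zK).
rewrite !zKM !zK_pow2 /= => Ea Eb.
have U n : 2 ^+ n != 0 :> K by rewrite expf_neq0.
rewrite !exprVn; apply/(canLR (mulfK (U e)))/esym.
rewrite mulrAC; apply/(canLR (mulfK (U e'))).
by rewrite !mulrDl Ea !(mulrAC _ iota) Eb.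
Qed.

Arguments phi : simpl never.

Lemma phi_dsum s : phi (dsum s) = \sum_(x <- s) phi x.
Proof.
elim: s => [|x s IH]; first by rewrite big_nil phi0.
by rewrite big_cons -IH -phiD.
Qed.

Definition e_ n : 'rV[K]_8 := \row_j (j == n :> nat)%:R.
Definition itp (v : vec) : 'rV[K]_8 := \sum_(p <- v) phi p.2 *: e_ p.1.

Definition linM (V : lmodType K) (T : nat -> V) (a : 'rV[K]_8) : V :=
  \sum_(i < 8) a 0 i *: T i.

Lemma linM_linear (V : lmodType K) (T : nat -> V) : linear (linM T).
Proof.
move=> c u v; rewrite /linM scaler_sumr -big_split; apply: eq_bigr => i _ /=.
by rewrite !mxE scalerDl scalerA.
Qed.

HB.instance Definition _ (V : lmodType K) (T : nat -> V) :=
  GRing.isLinear.Build K 'rV[K]_8 V _ (linM T) (linM_linear T).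

Lemma linM_e (V : lmodType K) (T : nat -> V) n :
  (n < 8)%N -> linM T (e_ n) = T n.
Proof.
move=> ltn; rewrite /linM (bigD1 (Ordinal ltn)) //= big1 => [|i ne].
  by rewrite mxE eqxx scale1r addr0.
rewrite mxE (_ : (i == n :> nat) = false) ?scale0r //.
by apply: contraNF ne => /eqP E; apply/eqP/val_inj.
Qed.

Lemma e_out n : (n < 8)%N = false -> e_ n = 0.
Proof.
move=> ltn; apply/rowP => j; rewrite !mxE; case: eqP => // E.
by move: (ltn_ord j); rewrite E ltn.
Qed.

Lemma eq_linM (V : lmodType K) (S T : nat -> V) :
  (forall n, (n < 8)%N -> S n = T n) -> linM S =1 linM T.
Proof. by move=> E a; apply: eq_bigr => i _; rewrite E. Qed.

Lemma rowE (a : 'rV[K]_8) : a = linM e_ a.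
Proof.
apply/rowP => j; rewrite /linM summxE (bigD1 j) //= big1 => [|i ne].
  by rewrite !mxE eqxx mulr1 addr0.
by rewrite !mxE (_ : (j == i :> nat) = false) ?mulr0 // eq_sym; apply: negbTE.
Qed.

Lemma linear_ext (V : lmodType K) (f g : 'rV[K]_8 -> V) : linear f -> linear g ->
  (forall n, (n < 8)%N -> f (e_ n) = g (e_ n)) -> f =1 g.
Proof.
move=> fl gl E a.
pose F : {linear 'rV[K]_8 -> V} := HB.pack f (GRing.isLinear.Build _ _ _ _ _ fl).
pose H : {linear 'rV[K]_8 -> V} := HB.pack g (GRing.isLinear.Build _ _ _ _ _ gl).
change (F a = H a); rewrite (rowE a) /linM !linear_sum; apply: eq_bigr => i _.
by rewrite !linearZ /= E.
Qed.

Lemma itpE v : itp v = \row_j phi (vcoef v j).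
Proof.
apply/rowP => j; rewrite !mxE phi_dsum big_map big_filter summxE.
rewrite [RHS]big_mkcond; apply: eq_bigr => p _; rewrite !mxE eq_sym.
by case: eqP; rewrite ?mulr1 ?mulr0.
Qed.

Lemma veqP u v : veq u v -> itp u = itp v.
Proof.
move=> /allP E; rewrite !itpE; apply/rowP => j; rewrite !mxE.
by apply/deqP/E; rewrite mem_iota /=.
Qed.

Lemma itp_E n : itp (vE n) = e_ n.
Proof. by rewrite /itp big_seq1 phi1 scale1r. Qed.
Lemma itp_nil : itp [::] = 0. Proof. by rewrite /itp big_nil. Qed.
Lemma itp_cat u v : itp (u ++ v) = itp u + itp v.
Proof. by rewrite /itp big_cat. Qed.
Lemma itp_scale c v : itp (vscale c v) = phi c *: itp v.
Proof.
rewrite /itp big_map scaler_sumr; apply: eq_bigr => p _.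
by rewrite phiM scalerA.
Qed.

Lemma linM_itp (V : lmodType K) (T : nat -> V) v :
  linM T (itp v) = \sum_(p <- v | (p.1 < 8)%N) phi p.2 *: T p.1.
Proof.
rewrite /itp linear_sum [RHS]big_mkcond; apply: eq_bigr => p _.
rewrite linearZ /=; case: ltnP => [lt|]; first by rewrite linM_e.
by rewrite leqNgt => /negbTE lt; rewrite e_out // linear0 scaler0.
Qed.

Lemma itp_lin T v : itp (vlin T v) = linM (fun n => itp (T n)) (itp v).
Proof.
rewrite linM_itp /vlin /itp big_flatten big_map big_filter.
by apply: eq_bigr => p _; rewrite -itp_scale.
Qed.

Variable k : nat.
Hypothesis ltk : (k < 4)%N.
Let zeta := iota ^+ k.

Lemma zeta4 : zeta ^+ 4 = 1.
Proof. by rewrite /zeta exprAC (exprM iota 2 2) iota2 sqrrN expr1n expr1n. Qed.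

Definition model of 2 != 0 :> K & iota ^+ 2 = -1 & (k < 4)%N : Type := 'rV[K]_8.
Notation M := (model two_neq0 iota2 ltk).

HB.instance Definition _ := Vector.copy M 'rV[K]_8.

Definition eM (n : nat) : M := e_ n.
Definition itpM (v : vec) : M := itp v.
Definition lin (V : lmodType K) (T : nat -> V) (a : M) : V := linM T a.

Lemma lin_linear (V : lmodType K) (T : nat -> V) : linear (lin T).
Proof. exact: linM_linear. Qed.
HB.instance Definition _ (V : lmodType K) (T : nat -> V) :=
  GRing.isLinear.Build K M V _ (lin T) (lin_linear T).

Lemma lin_e (V : lmodType K) (T : nat -> V) n :
  (n < 8)%N -> lin T (eM n) = T n.
Proof. exact: linM_e. Qed.
Lemma eq_lin (V : lmodType K) (S T : nat -> V) :
  (forall n, (n < 8)%N -> S n = T n) -> lin S =1 lin T.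
Proof. by move=> h a; apply: eq_linM. Qed.
Lemma M_ext (V : lmodType K) (f g : M -> V) : linear f -> linear g ->
  (forall n, (n < 8)%N -> f (eM n) = g (eM n)) -> f =1 g.
Proof. exact: linear_ext. Qed.
Lemma veqM u v : veq u v -> itpM u = itpM v. Proof. exact: veqP. Qed.
Lemma itpM_E n : itpM (vE n) = eM n. Proof. exact: itp_E. Qed.
Lemma itpM_nil : itpM [::] = 0. Proof. exact: itp_nil. Qed.
Lemma itpM_cat u v : itpM (u ++ v) = itpM u + itpM v. Proof. exact: itp_cat. Qed.
Lemma itpM_scale c v : itpM (vscale c v) = phi c *: itpM v.
Proof. exact: itp_scale. Qed.
Lemma itpM_lin T v : itpM (vlin T v) = lin (fun n => itpM (T n)) (itpM v).
Proof. exact: itp_lin. Qed.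
Lemma lin_itpM (V : lmodType K) (T : nat -> V) v :
  lin T (itpM v) = \sum_(p <- v | (p.1 < 8)%N) phi p.2 *: T p.1.
Proof. exact: linM_itp. Qed.
Lemma lin_sumD (V : lmodType K) (S T : nat -> V) c (a : M) :
  lin (fun n => c *: S n + T n) a = c *: lin S a + lin T a.
Proof.
rewrite /lin /linM scaler_sumr -big_split; apply: eq_bigr => i _ /=.
by rewrite scalerDr !scalerA mulrC.
Qed.

Definition mulM (a b : M) : M := lin (fun m => lin (fun n => itpM (mulT k m n)) b) a.

Lemma mulM_linl b : linear (mulM^~ b).
Proof. by move=> c u v; rewrite /mulM linearP. Qed.
Lemma mulM_linr a : linear (mulM a).
Proof.
move=> c u v; rewrite /mulM -lin_sumD; apply: eq_lin => n _.
by rewrite linearP.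
Qed.
HB.instance Definition _ a := GRing.isLinear.Build K M M _ (mulM a) (mulM_linr a).

Lemma itpM_mul u v : itpM (vmul k u v) = mulM (itpM u) (itpM v).
Proof.
by rewrite /vmul itpM_lin; apply: eq_lin => n _; rewrite itpM_lin.
Qed.

Lemma chkP (P : nat -> bool) : all P (seq.iota 0 4) -> P k.
Proof. by move/allP; apply; rewrite mem_iota. Qed.

Ltac chk c := let H0 := fresh "H" in
  assert (H0 : c k) by (apply: (@chkP c); vm_compute; reflexivity); unfold c in H0; move: H0.

Lemma mulMA : associative mulM.
Proof.
move=> a b c; apply: (M_ext (f := fun a => mulM a _) (g := fun a => mulM (mulM a b) c)).
- exact: mulM_linl.
- by move=> x u v; rewrite !mulM_linl.
move=> n ltn; move: b; apply: M_ext.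
- by move=> x u v; rewrite mulM_linl mulM_linr.
- by move=> x u v; rewrite mulM_linr mulM_linl.
move=> m ltm; move: c; apply: M_ext.
- by move=> x u v; rewrite !mulM_linr.
- by move=> x u v; rewrite !mulM_linr.
move=> l ltl; rewrite -!itpM_E -!itpM_mul; apply/esym/veqM; chk chk_assoc => H.
by move/allI_P/(_ n ltn)/allI_P/(_ m ltm)/allI_P/(_ l ltl): H.
Qed.

Lemma mul1M : left_id (eM 0) mulM.
Proof.
apply: M_ext => // [x u v|n ltn]; first by rewrite mulM_linr.
rewrite -!itpM_E -!itpM_mul; apply/veqM; chk chk_1 => H.
by move/allI_P/(_ n ltn)/andP: H => [].
Qed.
Lemma mulM1 : right_id (eM 0) mulM.
Proof.
apply: M_ext => // [x u v|n ltn]; first by rewrite mulM_linl.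
rewrite -!itpM_E -!itpM_mul; apply/veqM; chk chk_1 => H.
by move/allI_P/(_ n ltn)/andP: H => [].
Qed.
Lemma mulMDl : left_distributive mulM +%R.
Proof. by move=> a b c; have := mulM_linl c 1 a b; rewrite !scale1r. Qed.
Lemma mulMDr : right_distributive mulM +%R.
Proof. by move=> a b c; have := mulM_linr a 1 b c; rewrite !scale1r. Qed.
Lemma M1_neq0 : eM 0 != 0.
Proof.
apply/eqP => /rowP/(_ ord0)/eqP.
by rewrite !mxE /= oner_eq0.
Qed.

HB.instance Definition _ := GRing.Zmodule_isNzRing.Build M
  mulMA mul1M mulM1 mulMDl mulMDr M1_neq0.

Lemma scaleMAl (c : K) (a b : M) : c *: (a * b) = (c *: a) * b.
Proof. by have := mulM_linl b c a 0; rewrite [mulM 0 b]linear0 !addr0. Qed.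
Lemma scaleMAr (c : K) (a b : M) : c *: (a * b) = a * (c *: b).
Proof. by have := mulM_linr a c b 0; rewrite [mulM a 0]linear0 !addr0. Qed.

HB.instance Definition _ := GRing.Lmodule_isLalgebra.Build K M scaleMAl.
HB.instance Definition _ := GRing.Lalgebra_isAlgebra.Build K M scaleMAr.
HB.instance Definition _ := Algebra_isFalgebra.Build K M.

Lemma mulME (a b : M) : mulM a b = a * b. Proof. by []. Qed.
Lemma itpMM u v : itpM (vmul k u v) = itpM u * itpM v.
Proof. exact: itpM_mul. Qed.
Lemma oneM : eM 0 = 1. Proof. by []. Qed.

Definition gl i : M := itpM (glT k i).

Lemma gl_ext (V : lmodType K) (f g : M -> V) : linear f -> linear g ->
  (forall n, (n < 8)%N -> f (gl n) = g (gl n)) -> f =1 g.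
Proof.
move=> fl fr E; apply: M_ext => // n ltn.
chk chk_span => H; move: (allI_P H ltn) => /veqM.
rewrite itpM_E itpM_lin lin_itpM => ->.
pose F : {linear M -> V} := HB.pack f (GRing.isLinear.Build _ _ _ _ _ fl).
pose F' : {linear M -> V} := HB.pack g (GRing.isLinear.Build _ _ _ _ _ fr).
change (F (\sum_(p <- cT k n | (p.1 < 8)%N) phi p.2 *: gl p.1) =
        F' (\sum_(p <- cT k n | (p.1 < 8)%N) phi p.2 *: gl p.1)).
rewrite !linear_sum; apply: eq_bigr => p lt.
by rewrite !linearZ /= E.
Qed.

Definition titp (t : ten) : tensor M M :=
  \sum_(p <- t) phi p.2 *: tens (eM p.1.1) (eM p.1.2).

Lemma tens_suml (I : Type) (r : seq I) (P : pred I) (F : I -> M) (v : M) :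
  tens (\sum_(i <- r | P i) F i) v = \sum_(i <- r | P i) tens (F i) v.
Proof.
pose f : {linear M -> tensor M M} :=
  HB.pack (fun u => tens u v) (GRing.isLinear.Build _ _ _ _ _ (tens_linearl v)).
exact: (linear_sum f).
Qed.
Lemma tens_sumr (I : Type) (r : seq I) (P : pred I) (F : I -> M) (v : M) :
  tens v (\sum_(i <- r | P i) F i) = \sum_(i <- r | P i) tens v (F i).
Proof.
pose f : {linear M -> tensor M M} :=
  HB.pack (fun u => tens v u) (GRing.isLinear.Build _ _ _ _ _ (tens_linearr v)).
exact: (linear_sum f).
Qed.
Lemma tensZl c (u v : M) : tens (c *: u) v = c *: tens u v.
Proof.
pose f : {linear M -> tensor M M} :=
  HB.pack (fun u => tens u v) (GRing.isLinear.Build _ _ _ _ _ (tens_linearl v)).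
by rewrite -[LHS]/(f _) linearZ.
Qed.
Lemma tensZr c (u v : M) : tens v (c *: u) = c *: tens v u.
Proof.
pose f : {linear M -> tensor M M} :=
  HB.pack (fun u => tens v u) (GRing.isLinear.Build _ _ _ _ _ (tens_linearr v)).
by rewrite -[LHS]/(f _) linearZ.
Qed.
Lemma tens0l (v : M) : tens (0 : M) v = 0.
Proof. by rewrite -(scale0r v) tensZl scale0r. Qed.
Lemma tens0r (v : M) : tens v (0 : M) = 0.
Proof. by rewrite -(scale0r v) tensZr scale0r. Qed.

Lemma titp_outer u v : titp (touter u v) = tens (itpM u) (itpM v).
Proof.
rewrite [itpM u]/itpM /itp tens_suml /titp big_allpairs_dep.
apply: eq_bigr => p _; rewrite [itpM v]/itpM /itp tens_sumr.
by apply: eq_bigr => q _; rewrite tensZl tensZr scalerA /= phiM.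
Qed.

Lemma eM_out n : (n < 8)%N = false -> eM n = 0. Proof. exact: e_out. Qed.

Lemma titpE t : titp t =
  \sum_(i < 8) \sum_(j < 8) phi (tcoef t i j) *: tens (eM i) (eM j).
Proof.
transitivity (\sum_(i < 8) \sum_(j < 8) \sum_(p <- t | p.1 == (i : nat, j : nat))
                phi p.2 *: tens (eM i) (eM j)); last first.
  apply: eq_bigr => i _; apply: eq_bigr => j _.
  by rewrite phi_dsum big_map big_filter scaler_suml.
rewrite pair_bigA (exchange_big_dep xpredT) //=; apply: eq_bigr => -[[a b] c] _ /=.
have [lta|] := ltnP a 8; last first.
  move=> le; have E0 : eM a = 0 by apply: eM_out; rewrite ltnNge le.
  rewrite E0 tens0l scaler0 big1 // => p /eqP[E _].
  by move: le; rewrite E leqNgt ltn_ord.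
have [ltb|] := ltnP b 8; last first.
  move=> le; have E0 : eM b = 0 by apply: eM_out; rewrite ltnNge le.
  rewrite E0 tens0r scaler0 big1 // => p /eqP[_ E].
  by move: le; rewrite E leqNgt ltn_ord.
by rewrite (big_pred1 (Ordinal lta, Ordinal ltb)) // => -[i j]; rewrite eq_sym.
Qed.

Lemma teqM s t : teq s t -> titp s = titp t.
Proof.
move=> /allP E; rewrite !titpE; apply: eq_bigr => i _; apply: eq_bigr => j _.
congr (_ *: _); apply: deqP.
have mem (l : 'I_8) : val l \in I8 by rewrite mem_iota /=.
exact (allP (E _ (mem i)) _ (mem j)).
Qed.

Lemma titp_cat s t : titp (s ++ t) = titp s + titp t.
Proof. by rewrite /titp big_cat. Qed.
Lemma titp_scale c t : titp (tscale c t) = phi c *: titp t.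
Proof.
rewrite /titp big_map scaler_sumr; apply: eq_bigr => p _.
by rewrite phiM scalerA.
Qed.
Lemma titp_lin T v : titp (vlint T v) = lin (fun n => titp (T n)) (itpM v).
Proof.
rewrite lin_itpM /vlint /titp big_flatten big_map big_filter.
by apply: eq_bigr => p _; rewrite -titp_scale.
Qed.

Definition actM (g : G) : M -> M := lin (fun n => itpM (actT g.1 g.2 n)).
Definition coactM : M -> {ffun G -> M} :=
  lin (fun n => [ffun g : G => itpM (coactT k g.1 g.2 n)]).
Definition comulM : M -> tensor M M := lin (fun n => titp (comulT k n)).
Definition counitM : M -> K^o := lin (fun n => 1 : K^o).
Definition antM : M -> M := lin (fun n => itpM (antT k n)).
HB.instance Definition _ g := GRing.Linear.on (actM g).
HB.instance Definition _ := GRing.Linear.on coactM.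
HB.instance Definition _ := GRing.Linear.on comulM.
HB.instance Definition _ := GRing.Linear.on counitM.
HB.instance Definition _ := GRing.Linear.on antM.

Lemma itpM_act (g : G) v : itpM (vact g.1 g.2 v) = actM g (itpM v).
Proof. exact: itpM_lin. Qed.
Lemma itpM_coact (g : G) v : itpM (vcoact k g.1 g.2 v) = coactM (itpM v) g.
Proof.
rewrite itpM_lin [coactM _]lin_itpM lin_itpM sum_ffunE.
by apply: eq_bigr => p _; rewrite !ffunE.
Qed.
Lemma itpM_ant v : itpM (vant k v) = antM (itpM v).
Proof. exact: itpM_lin. Qed.
Lemma titp_comul v : titp (vcomul k v) = comulM (itpM v).
Proof. exact: titp_lin. Qed.
Lemma phi_eps v : phi (veps v) = counitM (itpM v).
Proof.
rewrite phi_dsum big_map big_filter [counitM _]lin_itpM.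
by apply: eq_bigr => p _; rewrite /GRing.scale /= mulr1.
Qed.

Lemma comul_gl i : (i < 8)%N -> comulM (gl i) = tens (gl i) (gl i).
Proof.
move=> lti; rewrite -titp_comul -titp_outer; apply: teqM.
by chk chk_comulgl => H; exact (allI_P H lti).
Qed.
Lemma counit_gl i : (i < 8)%N -> counitM (gl i) = 1.
Proof.
move=> lti; rewrite -phi_eps -phi1; apply: deqP.
by chk chk_epsgl => H; exact (allI_P H lti).
Qed.

Lemma coactD c (a b : M) g : coactM (c *: a + b) g = c *: coactM a g + coactM b g.
Proof. by rewrite linearP !ffunE. Qed.

Lemma M_act1 a : actM 1%g a = a.
Proof.
move: a; apply: M_ext => // [x u v|n ltn]; first by rewrite linearP.
rewrite -itpM_E -itpM_act; apply: veqM.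
have H : chk_act1 by vm_compute.
rewrite /chk_act1 in H.
exact (allI_P H ltn).
Qed.

Lemma M_actM g h a : actM (g * h)%g a = actM g (actM h a).
Proof.
move: a; apply: M_ext => [x u v|x u v|n ltn]; try by rewrite !linearP.
rewrite -itpM_E -!itpM_act nat1G nat2G; apply: veqM.
have H : chk_actM by vm_compute.
rewrite /chk_actM in H.
have H1 := allG_P H g. have H2 := allG_P H1 h.
exact (allI_P H2 ltn).
Qed.

Lemma M_coassoc a g h : coactM (coactM a g) h = if g == h then coactM a g else 0.
Proof.
move: a; apply: M_ext => [x u v|x u v|n ltn].
- by rewrite !coactD.
- by case: eqP; rewrite ?coactD // scaler0 addr0.
rewrite -itpM_E -!itpM_coact eqG; chk chk_coassoc => H.
have H1 := allG_P H g. have H2 := allG_P H1 h.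
move: (allI_P H2 ltn) => /veqM ->.
by case: ifP => _; [reflexivity | exact: itpM_nil].
Qed.

Lemma M_coactsum a : \sum_g coactM a g = a.
Proof.
move: a; apply: M_ext => // [x u v|n ltn].
  by rewrite scaler_sumr -big_split; apply: eq_bigr => g _; rewrite coactD.
rewrite sumG -itpM_E -!itpM_coact -!itpM_cat -!catA; apply: veqM.
by chk chk_coactsum => H; exact (allI_P H ltn).
Qed.

Lemma M_coactact g h a : coactM (actM g a) (g * h * g^-1)%g = actM g (coactM a h).
Proof.
have -> : (g * h * g^-1 = h)%g.
  by rewrite invG; move: h g; do 2!apply: G_case; congr pair; apply: val_inj.
move: a; apply: M_ext => [x u v|x u v|n ltn].
- by rewrite linearP coactD.
- by rewrite coactD linearP.
rewrite -itpM_E -itpM_act -!itpM_coact -itpM_act; apply: veqM; chk chk_coactact => H.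
have H1 := allG_P H g. have H2 := allG_P H1 h.
exact (allI_P H2 ltn).
Qed.

Lemma M_actunit g : actM g 1 = 1.
Proof.
rewrite -oneM -itpM_E -itpM_act; apply: veqM.
have H : chk_actunit by vm_compute.
rewrite /chk_actunit in H.
exact (allG_P H g).
Qed.

Lemma M_actmul g a b : actM g (a * b) = actM g a * actM g b.
Proof.
move: a; apply: M_ext => [x u v|x u v|n ltn].
- by rewrite mulrDl -scalerAl linearP.
- by rewrite linearP mulrDl -scalerAl.
move: b; apply: M_ext => [x u v|x u v|m ltm].
- by rewrite mulrDr -scalerAr linearP.
- by rewrite linearP mulrDr -scalerAr.
rewrite -!itpM_E -itpMM -!itpM_act -itpMM; apply: veqM; chk chk_actmul => H.
have H1 := allG_P H g. have H2 := allI_P H1 ltn.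
exact (allI_P H2 ltm).
Qed.

Lemma M_coactunit g : coactM 1 g = if g == 1%g then 1 else 0.
Proof.
rewrite -oneM -itpM_E -itpM_coact eqG1; chk chk_coactunit => H.
by move: (allG_P H g) => /veqM ->; case: ifP => _;
  [reflexivity | exact: itpM_nil].
Qed.

Lemma M_coactmul a b g :
  coactM (a * b) g = \sum_h coactM a h * coactM b (h^-1 * g)%g.
Proof.
move: a; apply: M_ext => [x u v|x u v|n ltn].
- by rewrite mulrDl -scalerAl coactD.
- rewrite scaler_sumr -big_split; apply: eq_bigr => h _.
  by rewrite coactD mulrDl -scalerAl.
move: b; apply: M_ext => [x u v|x u v|m ltm].
- by rewrite mulrDr -scalerAr coactD.
- rewrite scaler_sumr -big_split; apply: eq_bigr => h _.
  by rewrite coactD mulrDr -scalerAr.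
under eq_bigr do rewrite invG -!itpM_E -!itpM_coact nat1G nat2G -itpMM.
rewrite sumG -!itpM_E -itpMM -itpM_coact -!itpM_cat -!catA; apply: veqM.
chk chk_coactmul => H.
have H1 := allG_P H g. have H2 := allI_P H1 ltn.
exact (allI_P H2 ltm).
Qed.

Lemma comulD c (a b : M) : comulM (c *: a + b) = c *: comulM a + comulM b.
Proof. exact: linearP. Qed.

Lemma tmap_linear (U V U' V' : vectType K) (f : U -> U') (g : V -> V') :
  linear (tmap f g).
Proof. exact: tlift_linear. Qed.
Lemma tmap_tens (U V U' V' : vectType K) (f : U -> U') (g : V -> V') u v :
  linear f -> linear g -> tmap f g (tens u v) = tens (f u) (g v).
Proof.
move=> fl gl'; rewrite /tmap tlift_tens // => [w x a b|w x a b].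
  by rewrite fl tens_linearl.
by rewrite gl' tens_linearr.
Qed.
Lemma tassoc_tens (U V W : vectType K) (u : U) (v : V) (w : W) :
  tassoc (tens (tens u v) w) = tens u (tens v w).
Proof.
rewrite /tassoc tlift_tens => [|w' x a b|t x a b].
- rewrite tlift_tens // => [v' x a b|u' x a b]; first by rewrite tens_linearl.
  by rewrite tens_linearl tens_linearr.
- by rewrite tlift_linear.
rewrite /tlift scaler_sumr -big_split; apply: eq_bigr => i _ /=.
rewrite scaler_sumr -big_split; apply: eq_bigr => j _ /=.
by rewrite !tens_linearr scalerDr !scalerA mulrC.
Qed.
Lemma id_linear (U : lmodType K) : linear (@id U). Proof. by []. Qed.

Lemma M_comulassoc a :
  tassoc (tmap comulM id (comulM a)) = tmap id comulM (comulM a).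
Proof.
move: a; apply: gl_ext => [x u v|x u v|n ltn].
- by rewrite linearP tmap_linear [LHS]tlift_linear.
- by rewrite linearP tmap_linear.
rewrite comul_gl // !tmap_tens ?comul_gl ?tassoc_tens //;
  by [exact: linearP | exact: id_linear].
Qed.

Lemma M_counitl a : tlift (fun b c => counitM b *: c) (comulM a) = a.
Proof.
move: a; apply: gl_ext => [x u v|//|n ltn]; first by rewrite linearP tlift_linear.
rewrite comul_gl // tlift_tens ?counit_gl ?scale1r // => [v x a b|u x a b].
  by rewrite linearP scalerDl scalerA.
by rewrite scalerDr !scalerA mulrC.
Qed.
Lemma M_counitr a : tlift (fun b c => counitM c *: b) (comulM a) = a.
Proof.
move: a; apply: gl_ext => [x u v|//|n ltn]; first by rewrite linearP tlift_linear.
rewrite comul_gl // tlift_tens ?counit_gl ?scale1r // => [v x a b|u x a b].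
  by rewrite scalerDr !scalerA mulrC.
by rewrite linearP scalerDl scalerA.
Qed.

Lemma M_comulact g a : comulM (actM g a) = tmap (actM g) (actM g) (comulM a).
Proof.
move: a; apply: gl_ext => [x u v|x u v|n ltn].
- by rewrite !linearP.
- by rewrite linearP tmap_linear.
rewrite comul_gl // tmap_tens; try exact: linearP.
rewrite -itpM_act -titp_comul -titp_outer; apply: teqM; chk chk_comulact => H.
have H1 := allG_P H g.
exact (allI_P H1 ltn).
Qed.

Lemma M_comulcoact a g : tensor_coact coactM (comulM a) g = comulM (coactM a g).
Proof.
move: a; apply: gl_ext => [x u v|x u v|n ltn].
- by rewrite linearP [tensor_coact _ _]tlift_linear !ffunE.
- by rewrite coactD linearP.
rewrite comul_gl // /tensor_coact tlift_tens => [|v x a b|u x a b].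
- rewrite ffunE.
  under eq_bigr do rewrite invG -!itpM_coact nat1G nat2G -titp_outer.
  rewrite sumG -itpM_coact -titp_comul -!titp_cat -!catA; apply: teqM.
  chk chk_comulcoact => H. have H1 := allG_P H g.
  exact (allI_P H1 ltn).
- apply/ffunP => h; rewrite !ffunE scaler_sumr -big_split; apply: eq_bigr => l _.
  by rewrite coactD tens_linearl.
apply/ffunP => h; rewrite !ffunE scaler_sumr -big_split; apply: eq_bigr => l _.
by rewrite coactD tens_linearr.
Qed.

Lemma M_counitact g a : counitM (actM g a) = counitM a.
Proof.
move: a; apply: M_ext => [x u v|x u v|n ltn]; try by rewrite !linearP.
rewrite -itpM_E -itpM_act -!phi_eps; apply: deqP.
have H : chk_epsact by vm_compute.
rewrite /chk_epsact in H.
have H1 := allG_P H g.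
exact (allI_P H1 ltn).
Qed.
Lemma M_counitcoact a g :
  counitM (coactM a g) = if g == 1%g then counitM a else 0.
Proof.
move: a; apply: M_ext => [x u v|x u v|n ltn].
- by rewrite coactD linearP.
- by case: eqP; rewrite ?linearP // scaler0 addr0.
rewrite -itpM_E -itpM_coact -!phi_eps eqG1 -phi0 -fun_if; apply: deqP.
chk chk_epscoact => H. have H1 := allG_P H g.
exact (allI_P H1 ltn).
Qed.

Lemma gl0 : gl 0 = 1. Proof. exact: itpM_E. Qed.
Lemma M_comulunit : comulM 1 = tens (1 : M) (1 : M).
Proof. by rewrite -gl0 comul_gl. Qed.
Lemma M_counitunit : counitM 1 = 1.
Proof. by rewrite -gl0 counit_gl. Qed.

Lemma tlift_param (U V : vectType K) (W : lmodType K) (f f1 f2 : U -> V -> W) c t :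
  (forall a b, f a b = c *: f1 a b + f2 a b) ->
  tlift f t = c *: tlift f1 t + tlift f2 t.
Proof.
move=> E; rewrite /tlift scaler_sumr -big_split; apply: eq_bigr => i _ /=.
rewrite scaler_sumr -big_split; apply: eq_bigr => j _ /=.
by rewrite E scalerDr !scalerA mulrC.
Qed.

Let bmul := braided_mul actM coactM.
Lemma bmul_linearl t : linear (bmul^~ t).
Proof. by move=> c u v; exact: tlift_linear. Qed.
Lemma bmul_linearr t : linear (bmul t).
Proof.
by move=> c u v; apply: tlift_param => a b; exact: tlift_linear.
Qed.
Lemma bmul_tens (a b c d : M) : bmul (tens a b) (tens c d) =
  \sum_g tens (a * actM g c) (coactM b g * d).
Proof.
have inner (a' b' : M) : tlift (fun c d => \sum_g tens (a' * actM g c) (coactM b' g * d))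
    (tens c d) = \sum_g tens (a' * actM g c) (coactM b' g * d).
  rewrite tlift_tens // => [v x s t|u x s t];
    rewrite scaler_sumr -big_split; apply: eq_bigr => g _.
  - by rewrite linearP mulrDr -scalerAr tens_linearl.
  - by rewrite mulrDr -scalerAr tens_linearr.
rewrite /bmul /braided_mul tlift_tens ?inner // => [v x s t|u x s t];
  rewrite !inner scaler_sumr -big_split; apply: eq_bigr => g _.
- by rewrite mulrDl -scalerAl tens_linearl.
- by rewrite coactD mulrDl -scalerAl tens_linearr.
Qed.

Lemma M_comulmul a b : comulM (a * b) = bmul (comulM a) (comulM b).
Proof.
move: a; apply: gl_ext => [x u v|x u v|n ltn].
- by rewrite mulrDl -scalerAl linearP.
- by rewrite linearP bmul_linearl.
move: b; apply: gl_ext => [x u v|x u v|m ltm].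
- by rewrite mulrDr -scalerAr linearP.
- by rewrite linearP bmul_linearr.
rewrite !comul_gl // bmul_tens.
under eq_bigr do rewrite -itpM_act -itpM_coact -!itpMM -titp_outer.
rewrite sumG -itpMM -titp_comul -!titp_cat -!catA; apply: teqM; chk chk_comulmul => H.
have H1 := allI_P H ltn.
exact (allI_P H1 ltm).
Qed.

Lemma M_counitmul a b : counitM (a * b) = counitM a * counitM b.
Proof.
move: a; apply: M_ext => [x u v|x u v|n ltn].
- by rewrite mulrDl -scalerAl linearP.
- by rewrite linearP mulrDl -scalerAl.
move: b; apply: M_ext => [x u v|x u v|m ltm].
- by rewrite mulrDr -scalerAr linearP.
- by rewrite linearP mulrDr -scalerAr.
rewrite ![counitM (eM _)]lin_e // mulr1 -!itpM_E -itpMM -phi_eps -phi1.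
apply: deqP; chk chk_epsmul => H. have H1 := allI_P H ltn.
exact (allI_P H1 ltm).
Qed.

Lemma M_antl a : tlift (fun b c => antM b * c) (comulM a) = counitM a *: 1.
Proof.
move: a; apply: gl_ext => [x u v|x u v|n ltn].
- by rewrite linearP tlift_linear.
- by rewrite linearP scalerDl scalerA.
rewrite comul_gl // counit_gl // scale1r tlift_tens => [|v x a b|u x a b].
- rewrite -itpM_ant -itpMM -oneM -itpM_E; apply: veqM; chk chk_ant => H.
  by move: (allI_P H ltn) => /andP[].
- by rewrite linearP mulrDl -scalerAl.
- by rewrite mulrDr -scalerAr.
Qed.
Lemma M_antr a : tlift (fun b c => b * antM c) (comulM a) = counitM a *: 1.
Proof.
move: a; apply: gl_ext => [x u v|x u v|n ltn].
- by rewrite linearP tlift_linear.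
- by rewrite linearP scalerDl scalerA.
rewrite comul_gl // counit_gl // scale1r tlift_tens => [|v x a b|u x a b].
- rewrite -itpM_ant -itpMM -oneM -itpM_E; apply: veqM; chk chk_ant => H.
  by move: (allI_P H ltn) => /andP[].
- by rewrite mulrDl -scalerAl.
- by rewrite linearP mulrDr -scalerAr.
Qed.
Lemma M_antact g a : antM (actM g a) = actM g (antM a).
Proof.
move: a; apply: M_ext => [x u v|x u v|n ltn]; try by rewrite !linearP.
rewrite -itpM_E -itpM_act -!itpM_ant -itpM_act; apply: veqM; chk chk_antact => H.
have H1 := allG_P H g.
exact (allI_P H1 ltn).
Qed.
Lemma M_antcoact a g : coactM (antM a) g = antM (coactM a g).
Proof.
move: a; apply: M_ext => [x u v|x u v|n ltn].
- by rewrite linearP coactD.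
- by rewrite coactD linearP.
rewrite -itpM_E -itpM_ant -!itpM_coact -itpM_ant; apply: veqM; chk chk_antcoact => H.
have H1 := allG_P H g.
exact (allI_P H1 ltn).
Qed.

Definition model_ydHopf : ydHopf K G :=
  @YDHopf K G M actM coactM comulM counitM antM
    M_act1 M_actM M_coassoc M_coactsum M_coactact
    M_actunit M_actmul M_coactunit M_coactmul
    M_comulassoc M_counitl M_counitr M_comulact M_comulcoact
    M_counitact M_counitcoact M_comulunit M_comulmul M_counitunit M_counitmul
    M_antl M_antr M_antact M_antcoact.

Arguments uT : simpl never.

Let x : M := eM 1.
Let y : M := eM 4.

Lemma eM_mul i j : (i < 8)%N -> (j < 8)%N -> eM i * eM j = itpM (mulT k i j).
Proof. by move=> lti ltj; rewrite -mulME /mulM !lin_e. Qed.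

Lemma phi_dz : phi (dz k) = zeta. Proof. by rewrite phiX phi_i. Qed.

Lemma x2E : x ^+ 2 = eM 2.
Proof. by rewrite expr2 eM_mul // -itpM_E; apply: veqM; vm_compute. Qed.
Lemma x3E : x ^+ 3 = eM 3.
Proof. by rewrite exprS x2E eM_mul // -itpM_E; apply: veqM; vm_compute. Qed.

Lemma monE n : (n < 8)%N -> eM n = x ^+ (n %% 4) * y ^+ (n %/ 4).
Proof.
case: n => [|[|[|[|[|[|[|[|]]]]]]]] //= _; rewrite ?(mulr1, mul1r) ?expr0 ?expr1;
  by rewrite ?x2E ?x3E // eM_mul // -itpM_E; apply: veqM; vm_compute.
Qed.

Lemma phi_uT l : phi (uT k l) = 2^-1 * nth 0 [:: zeta; 1; - zeta; 1] (l %% 4).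
Proof.
have: (l %% 4 < 4)%N by rewrite ltn_mod.
rewrite /uT phiM phi_half; case: (l %% 4)%N => [|[|[|[|]]]] //= _;
  by rewrite ?phiN ?phi_dz ?phi1.
Qed.

Lemma M_relations : relations zeta x y.
Proof.
split.
- by rewrite exprS x3E eM_mul // -oneM -itpM_E; apply: veqM; vm_compute.
- by rewrite x3E !eM_mul //; apply: veqM; vm_compute.
rewrite expr2 eM_mul // x2E x3E -oneM [LHS]/itpM /itp /mulT big_map.
rewrite !big_cons big_nil !phi_uT /= !mulr1 addr0 !mulrN -!scalerA !scaleNr.
by rewrite -!scalerA !scalerDr !scalerN !scalerA !addrA.
Qed.

Section Universal.
Variables (B : algType K) (x' y' : B).
Hypothesis rel : relations zeta x' y'.

Let mon n := x' ^+ (n %% 4) * y' ^+ (n %/ 4).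
Definition univ : M -> B := lin mon.
HB.instance Definition _ := GRing.Linear.on univ.

Lemma univ_yx j : y' * x' ^+ j = x' ^+ (3 * j) * y'.
Proof.
have [x4 xy _] := rel.
have yx : y' * x' = x' ^+ 3 * y'.
  rewrite !exprSr expr0 mul1r -!mulrA xy (mulrA x' y') xy -mulrA -exprD.
  rewrite (mulrA x') xy -mulrA -exprD (_ : (3 + (3 + 3) = 4 + 4 + 1)%N) //.
  by rewrite !exprD x4 !mul1r expr1.
elim: j => [|j IH]; first by rewrite muln0 !expr0 mulr1 mul1r.
by rewrite exprSr mulrA IH -mulrA yx mulrA -exprD mulnS addnC.
Qed.

Lemma univ_mon m n : (m < 8)%N -> (n < 8)%N -> univ (itpM (mulT k m n)) = mon m * mon n.
Proof.
move=> ltm ltn; rewrite /univ lin_itpM /mulT /mon.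
have [x4 _ y2] := rel.
have lta : (m %/ 4 < 2)%N by rewrite ltn_divLR.
have ltb : (n %/ 4 < 2)%N by rewrite ltn_divLR.
have e4 e c : (c < 2)%N -> [/\ (e %% 4 + 4 * c < 8)%N,
    ((e %% 4 + 4 * c) %% 4 = e %% 4)%N & ((e %% 4 + 4 * c) %/ 4 = c)%N].
  move=> ltc; have lt4 : (e %% 4 < 4)%N by rewrite ltn_mod.
  split; last 2 first.
  - by rewrite addnC mulnC modnMDl modn_mod.
  - by rewrite addnC mulnC divnMDl // divn_small // addn0.
  apply: (@leq_trans (4 + 4 * c)%N); first by rewrite -addSn leq_add2r.
  by case: c ltc => [|[|]].
case: (m %/ 4)%N lta => [|[|]] // _; case: (n %/ 4)%N ltb => [|[|]] // _ /=.
- have [lt E1 E2] := e4 (m %% 4 + n %% 4)%N 0%N isT.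
  rewrite big_cons big_nil [_.1]/= [_.2]/= lt E1 E2 addr0 phi1 scale1r !expr_mod // !expr0 !mulr1.
  by rewrite exprD !expr_mod.
- have [lt E1 E2] := e4 (m %% 4 + n %% 4)%N 1%N isT.
  rewrite big_cons big_nil [_.1]/= [_.2]/= lt E1 E2 addr0 phi1 scale1r !expr_mod // !expr0 !mulr1 !expr1.
  by rewrite exprD !expr_mod // mulrA.
- have [lt E1 E2] := e4 (m %% 4 + 3 * (n %% 4))%N 1%N isT.
  rewrite big_cons big_nil [_.1]/= [_.2]/= lt E1 E2 addr0 phi1 scale1r (expr_mod (m %% 4 + _) x4) !expr1 mulr1.
  by rewrite -mulrA univ_yx exprD mulrA.
rewrite !expr1 mulrA -(mulrA _ y') univ_yx -!mulrA -expr2 mulrA -exprD y2.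
set e := (m %% 4 + _)%N.
have lt l : ((e + l) %% 4 < 8)%N by rewrite (@ltn_trans 4) // ltn_mod.
have dv l : ((e + l) %% 4 %/ 4 = 0)%N by rewrite divn_small // ltn_mod.
rewrite !big_cons big_nil /= !lt !dv !modn_mod !phi_uT !expr_mod // !exprD /=.
rewrite !expr0 !mulr1 addr0 -!scalerA -!scalerDr -scalerAr.
congr (_ *: _); rewrite !mulrDr mulrN -!scalerAr mulr1 expr1 scaleNr !addrA.
by [].
Qed.

Lemma univ_monoid : monoid_morphism univ.
Proof.
split=> [|a b]; first by rewrite -oneM /univ lin_e // /mon !expr0 mulr1.
move: a; apply: M_ext => [c u v|c u v|m ltm].
- by rewrite mulrDl -scalerAl linearP.
- by rewrite linearP mulrDl -scalerAl.
move: b; apply: M_ext => [c u v|c u v|n ltn].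
- by rewrite mulrDr -scalerAr linearP.
- by rewrite linearP mulrDr -scalerAr.
by rewrite eM_mul // univ_mon // /univ !lin_e.
Qed.
End Universal.

Lemma M_presented : presented_by zeta x y.
Proof.
split=> [|B x' y' rel]; first exact: M_relations.
pose f : {lrmorphism M -> B} := HB.pack (univ x' y')
  (GRing.isMonoidMorphism.Build M B (univ x' y') (univ_monoid rel)).
exists f; split.
- by rewrite /= /univ lin_e //= expr1 mulr1.
- by rewrite /= /univ lin_e //= expr1 mul1r.
move=> f' fx fy; apply: M_ext; try exact: linearP.
move=> n ltn; rewrite /= /univ lin_e // -fx -fy -!rmorphXn -rmorphM.
by rewrite -monE.
Qed.

Lemma phi_dz2 : phi (dz2 k) = zeta ^+ 2.
Proof. by rewrite phiM phi_dz. Qed.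

Lemma phi_theta (g h : G) : phi (thetaT k g.1 g.2 h.1 h.2) = theta zeta g h.
Proof. by rewrite phiM !phiX phiN phi1 phi_dz2. Qed.

Lemma act_e (g : G) n m : (n < 8)%N ->
  veq (actT g.1 g.2 n) (vE m) -> actM g (eM n) = eM m.
Proof. by move=> ltn /veqM; rewrite itpM_E /actM lin_e. Qed.

Lemma M_coact a g : coactM a g = 4^-1 *: \sum_h theta zeta g h *: actM h a.
Proof.
move: a; apply: M_ext => [c u v|c u v|n ltn].
- exact: coactD.
- rewrite scalerA mulrC -scalerA -scalerDr; congr (_ *: _).
  rewrite scaler_sumr -big_split; apply: eq_bigr => h _.
  by rewrite linearP scalerDr !scalerA mulrC.
rewrite sumG /coactM lin_e // ffunE /coactT !itpM_cat !itpM_scale.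
have E t : phi (dmul (dmul dhalf dhalf) t) = 2^-1 * (2^-1 * phi t).
  by rewrite phiM phiM phi_half mulrA.
rewrite !{}E.
rewrite /actM !lin_e //.
have -> : 4^-1 = 2^-1 * 2^-1 :> K by rewrite -invfM -natrM.
by rewrite -!phi_theta -!scalerA -!scalerDr !addrA.
Qed.

Lemma M_grouplike i : (i < 8)%N -> @grouplike K G model_ydHopf (gl i).
Proof. by move=> lti; split; [exact: comul_gl | exact: counit_gl]. Qed.

Lemma phi_wp : phi (wp k) = 2^-1 * (1 + iota * zeta ^+ 2).
Proof. by rewrite phiM phi_half phiD phi1 phiM phi_i phi_dz2. Qed.
Lemma phi_wm : phi (wm k) = 2^-1 * (1 - iota * zeta ^+ 2).
Proof. by rewrite phiM phi_half phiD phiN phi1 phiM phi_i phi_dz2. Qed.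

Lemma M_second_family : @second_family K iota zeta model_ydHopf.
Proof.
exists x, y; split.
- exact: M_presented.
- have x3 : x ^+ 3 = eM 3 by exact: x3E.
  have xy n : (n < 4)%N -> x ^+ n * y = eM (n + 4).
    move=> ltn; rewrite [RHS]monE ?(ltn_add2r 4 n 4) // modnDr modn_small //.
    by rewrite divnDr // divn_small // expr1.
  split.
  + by rewrite [RHS]x3; apply: act_e => //; vm_compute.
  + by rewrite [RHS](xy 3%N) //; apply: act_e => //; vm_compute.
  + by apply: act_e => //; vm_compute.
  + by rewrite [RHS](xy 2%N) //; apply: act_e => //; vm_compute.
- exact: M_coact.
have w i (a : M) : (i < 8)%N -> gl i = a -> @grouplike K G model_ydHopf a.
  by move=> lti <-; exact: M_grouplike.
have xy n : (n < 4)%N -> x ^+ n * y = eM (n + 4).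
  move=> ltn; rewrite [RHS]monE ?(ltn_add2r 4 n 4) // modnDr modn_small //.
  by rewrite divnDr // divn_small // expr1.
have glE i : veq (glT k i) (vE i) -> gl i = eM i by move/veqM; rewrite itpM_E.
move=> a; rewrite !inE.
do ![case/orP | move/eqP->].
- by apply: (w 0%N) => //; rewrite glE //; vm_compute.
- apply: (w 1%N) => //; rewrite /gl /omega2 x3E /itpM /itp /= !big_cons big_nil.
  by rewrite /= phi_wp phi_wm addr0.
- apply: (w 3%N) => //; rewrite /gl /omega3 x3E /itpM /itp /= !big_cons big_nil.
  by rewrite /= phi_wp phi_wm addr0.
- by apply: (w 2%N) => //; rewrite x2E glE //; vm_compute.
- by apply: (w 4%N) => //; rewrite glE //; vm_compute.
- by apply: (w 7%N) => //; rewrite [RHS](xy 3%N) // glE //; vm_compute.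
- by apply: (w 6%N) => //; rewrite [RHS](xy 2%N) // glE //; vm_compute.
by apply: (w 5%N) => //; rewrite -[x in RHS]expr1 [RHS](xy 1%N) // glE //; vm_compute.
Qed.

End Interpretation.
End Model.

Lemma second_family_exists (K : fieldType) (charK : [pchar K] =i pred0)
    (iota zeta : K) (iotaP : 4.-primitive_root iota) (zeta4 : zeta ^+ 4 = 1) :
  exists A : ydHopf K G, second_family iota zeta A.
Proof.
have two_neq0 : 2 != 0 :> K by have := charK 2; rewrite !inE /= => ->.
have iota2 : iota ^+ 2 = -1.
  have /eqP : (iota ^+ 2) ^+ 2 = 1 by rewrite -exprM (prim_expr_order iotaP).
  rewrite sqrf_eq1 => /orP[|/eqP//].
  by rewrite -(prim_order_dvd iotaP).
have [[k ltk] ->] := prim_rootP iotaP zeta4.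
by exists (Model.model_ydHopf two_neq0 iota2 ltk); exact: Model.M_second_family.
Qed.

(* Main.v *)
(* An isomorphism f : A_zeta -> A_xi preserves group-like elements.  Distinct
   group-likes are linearly independent, and the eight listed ones span, so
   f y is one of them; as g3 moves y, it is x^i y for some i.  Comparing the
   images of g3.y = x^2 y and g2.y = x^3 y, and cancelling the invertible f y,
   gives f x = x^(2i+1), whence f (x + x^3) = x + x^3 and f (x^2) = x^2; moreover
   (x^i y)^2 = y^2.  The relation for y^2 then yields (zeta - xi)(1 - x^2) = 0,
   while x^2 <> 1 because x^2 acts as -1 in a two-dimensional representation. *)
From HB Require Import structures.
Require Import Defs.
From mathcomp Require Import all_boot all_order all_algebra all_fingroup all_field.
From mathcomp Require Import zify ring.

Set Implicit Arguments.
Unset Strict Implicit.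
Unset Printing Implicit Defensive.

Import GRing.Theory.
Local Open Scope ring_scope.

(** * Linear independence of group-like elements *)

Lemma free_subseq_span (K : fieldType) (V : vectType K) (s : seq V) :
  exists s' : seq V, [/\ {subset s' <= s}, free s' & <<s'>>%VS = <<s>>%VS].
Proof.
elim: s => [|v s [s' [sub fr eqs]]]; first by exists [::]; rewrite nil_free.
have [vs|vNs] := boolP (v \in <<s>>%VS).
  exists s'; split => // [u /sub us|]; first by rewrite inE us orbT.
  by rewrite eqs span_cons; apply/esym/addv_idPr; rewrite -memvE.
exists (v :: s'); split; last by rewrite !span_cons eqs.
- by move=> u; rewrite !inE => /orP[->|/sub ->] //; rewrite orbT.
- by rewrite free_cons eqs vNs.
Qed.

Section GroupLike.
Variables (K : fieldType) (gT : finGroupType).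

(** Pairing [comul a = tens a a] with two coordinate forms gives c_i c_j = delta_ij c_i for the
    coordinates of [a]. They are thus orthogonal idempotents of the field, not all zero because
    [counit a = 1], so exactly one is 1. *)
Lemma grouplike_free_span (A : ydHopf K gT) n (s : n.-tuple A) (a : A) :
  free s -> {in s, forall b, grouplike b} -> grouplike a ->
  a \in <<s>>%VS -> a \in s.
Proof.
move=> fr gs [ca ea] ain.
have defa := coord_span ain.
pose m i j : A -> A -> K^o := fun u v => coord s i u * coord s j v.
have ml i j v : linear ((m i j)^~ v).
  by move=> c u u'; rewrite /m linearP mulrDl -mulrA.
have mr i j u : linear (m i j u).
  by move=> c v v'; rewrite /m linearP mulrDr mulrCA.
have tm i j : exists L : {linear tensor A A -> K^o}, L =1 tlift (m i j).
  pose T := GRing.isLinear.Build K (tensor A A) K^o _ (tlift (m i j))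
              (tlift_linear (m i j)).
  pose L : {linear tensor A A -> K^o} := HB.pack (tlift (m i j)) T.
  by exists L.
(* [tlift (m i j) (comul a)] is computed twice: from [a] being group-like, and by expanding [a] in
   the group-likes of [s]. *)
have cc i j : coord s i a * coord s j a = (i == j)%:R * coord s i a.
  transitivity (tlift (m i j) (comul a)); first by rewrite ca tlift_tens.
  have [L LE] := tm i j.
  rewrite -LE {1}defa !linear_sum (bigD1 i) //= !linearZ /= LE.
  have sg (k : 'I_n) : comul s`_k = tens s`_k s`_k :> tensor A A.
    have ks : s`_k \in s by rewrite mem_nth // size_tuple.
    by case: (gs _ ks).
  rewrite big1 ?addr0 => [|k kNi]; last first.
    rewrite !linearZ /= LE sg tlift_tens // /m coord_free //.
    by rewrite (negbTE kNi) mul0r scaler0.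
  rewrite sg tlift_tens // /m !coord_free // eqxx mul1r; exact: mulrC.
have [i ci] : exists i, coord s i a != 0.
  apply/existsP; apply: contra_eqT ea; rewrite negb_exists => /forallP c0.
  rewrite defa big1 ?linear0 1?eq_sym ?oner_neq0 // => i _.
  by move: (c0 i); rewrite negbK => /eqP ->; rewrite scale0r.
have ci1 : coord s i a = 1.
  by apply: (mulfI ci); rewrite cc eqxx mul1r mulr1.
rewrite defa (bigD1 i) //= big1 => [|j jNi]; last first.
  have := cc i j; rewrite ci1 mul1r mulr1 eq_sym (negbTE jNi) => ->.
  by rewrite scale0r.
by rewrite ci1 scale1r addr0 mem_nth // size_tuple.
Qed.

(** Passing to a free subsequence with the same span spares a proof that the members of [s] are
    distinct. *)
Lemma grouplike_span (A : ydHopf K gT) (s : seq A) (a : A) :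
  {in s, forall b, grouplike b} -> grouplike a -> a \in <<s>>%VS -> a \in s.
Proof.
move=> gs ga; have [s' [sub fr <-]] := free_subseq_span s => ain.
apply: (sub a); apply: (grouplike_free_span (s := in_tuple s')) => // b /sub.
exact: gs.
Qed.

Lemma grouplike_morph (A B : ydHopf K gT) (f : {linear A -> B}) (a : A) :
  (forall a, comul (f a) = tmap f f (comul a)) ->
  (forall a, counit (f a) = counit a) -> grouplike a -> grouplike (f a).
Proof.
move=> fc fe [ca ea]; split; last by rewrite fe.
rewrite fc ca /tmap tlift_tens // => v c u u'; rewrite linearP.
  exact: tens_linearl.
exact: tens_linearr.
Qed.

End GroupLike.

Lemma act_exp (K : fieldType) (gT : finGroupType) (A : ydHopf K gT) g (a : A) n :
  Defs.act g (a ^+ n) = Defs.act g a ^+ n.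
Proof.
elim: n => [|n IH]; first by rewrite !expr0 act_unit.
by rewrite !exprS act_mul IH.
Qed.

(** * Consequences of the relations: moving y past x, and cancelling y *)

Section Relations.
Variables (K : fieldType) (zeta : K) (B : algType K) (x y : B).
Hypothesis rel : relations zeta x y.

Lemma relations_yx n : y * x ^+ n = x ^+ (3 * n) * y.
Proof.
have [x4 xy _] := rel.
have yx : y * x = x ^+ 3 * y.
  (* Moving y to the left turns x^3 y into y x^9, and x^8 = 1. *)
  rewrite !exprSr expr0 mul1r -!mulrA xy (mulrA x y) xy -mulrA -exprD.
  rewrite (mulrA x) xy -mulrA -exprD (_ : (3 + (3 + 3) = 4 + 4 + 1)%N) //.
  by rewrite !exprD x4 !mul1r expr1.
elim: n => [|n IH]; first by rewrite muln0 !expr0 mulr1 mul1r.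
by rewrite exprSr mulrA IH -mulrA yx mulrA -exprD mulnS addnC.
Qed.

Hypotheses (two_neq0 : 2 != 0 :> K) (zeta4 : zeta ^+ 4 = 1).

(* At x = 1, -1, iota, -iota the right-hand side of the relation for y^2 takes
   the values 1, -1, zeta, zeta, so replacing zeta by its inverse zeta^3 in it
   gives the inverse. *)
Lemma relations_y_inv : exists z, y * z = 1.
Proof.
have [x4 xy y2] := rel.
pose q (c : K) : {poly K} :=
  2^-1%:P * (c%:P * (1 - 'X^2) + 'X + 'X^3).
have qE c : horner_alg x (q c) =
    2^-1 *: (c *: 1 + x - c *: x ^+ 2 + x ^+ 3).
  rewrite /q rmorphM !rmorphD rmorphM rmorphB rmorph1 /= !rmorphXn /=.
  rewrite !horner_algC !horner_algX -!scalerAl !mul1r.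
  by congr (_ *: (_ + _)); rewrite scalerBr addrAC.
exists (y * horner_alg x (q (zeta ^+ 3))).
rewrite mulrA -expr2 y2 -qE -rmorphM.
(* The cofactor is the quotient of [q zeta * q (zeta ^+ 3) - 1] by X^4 - 1; the multiple of X^4 - 1
   vanishes at x. *)
have -> : q zeta * q (zeta ^+ 3) =
    1 + ('X^4 - 1) * ((2^-1 * 2^-1)%:P *
          (3%:R + 'X^2 - (zeta + zeta ^+ 3)%:P * 'X)).
  rewrite /q.
  have h : 2^-1%:P * 2 = 1 :> {poly K}.
    by rewrite -polyC_natr -polyCM mulVf.
  have z4 : zeta%:P ^+ 4 = 1 :> {poly K} by rewrite -polyC_exp zeta4.
  (* Writing 1 as (2^-1 * 2)^2 leaves an identity in which 2^-1 can be an indeterminate for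
     [ring]. *)
  transitivity ((2^-1%:P * 2) ^+ 2 + ('X^4 - 1) *
    ((2^-1 * 2^-1)%:P * (3%:R + 'X^2 - (zeta + zeta ^+ 3)%:P * 'X)));
    last by rewrite h expr1n.
  rewrite polyCM polyCD polyC_exp.
  set h2 := 2^-1%:P; set z := zeta%:P in z4 *.
  ring: z4.
rewrite rmorphD rmorph1 rmorphM rmorphB rmorph1 /= rmorphXn /= horner_algX.
by rewrite x4 subrr mul0r addr0.
Qed.

Lemma relations_y_cancel u v : u * y = v * y -> u = v.
Proof.
have [z yz] := relations_y_inv; move=> /(congr1 (fun w => w * z)).
by rewrite -!mulrA yz !mulr1.
Qed.

End Relations.

(** * The presented algebra: spanning monomials, and x^2 <> 1 *)

Section Presentation.
Variables (K : fieldType) (zeta : K).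

Lemma relations_inj (A B : algType K) (f : {lrmorphism A -> B}) (x y : A) :
  injective f -> relations zeta (f x) (f y) -> relations zeta x y.
Proof.
move=> fI [x4 xy y2]; split; apply: fI.
- by rewrite rmorphXn rmorph1.
- by rewrite rmorphM xy rmorphM rmorphXn.
- rewrite rmorphXn y2 -(rmorph1 f) -!(rmorphXn f) -!(linearZ_LR f).
  by rewrite -(rmorphD f) -(rmorphB f) -(rmorphD f) -(linearZ_LR f).
Qed.

Lemma relations_morph (A B : algType K) (f : {lrmorphism A -> B}) (x y : A) :
  relations zeta x y -> relations zeta (f x) (f y).
Proof.
move=> [x4 xy y2]; split.
- by rewrite -rmorphXn x4 rmorph1.
- by rewrite -(rmorphXn f) -!(rmorphM f) xy.
- rewrite -(rmorphXn f) y2 -(rmorph1 f) -!(rmorphXn f) -!(linearZ_LR f).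
  by rewrite -(rmorphD f) -(rmorphB f) -(rmorphD f) -(linearZ_LR f).
Qed.

(** The universal property gives a map from [A] to [U] fixing x and y. Followed by the inclusion it
    is the identity of [A], by uniqueness, so every element lies in [U]. *)
Lemma presented_subalg (A : falgType K) (x y : A) (U : {aspace A}) :
  presented_by zeta x y -> 1 \in U -> x \in U -> y \in U -> U = fullv :> {vspace A}.
Proof.
move=> [rel univ] U1 xU yU.
have vM : monoid_morphism (vsval : subvs_of U -> A).
  by split=> //=; apply/eqP; rewrite algid_eq1.
have vL : linear (vsval : subvs_of U -> A) by move=> c a b; rewrite linearP.
pose v : {lrmorphism subvs_of U -> A} := HB.pack (vsval : subvs_of U -> A)
  (GRing.isLinear.Build K (subvs_of U) A _ _ vL)
  (GRing.isMonoidMorphism.Build (subvs_of U) A _ vM).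
have relU : relations zeta (Subvs xU) (Subvs yU).
  exact: (relations_inj (f := v) val_inj).
have [h [hx hy _]] := univ _ _ _ relU.
have [i [_ _ iuniq]] := univ _ _ _ rel.
apply/eqP; rewrite eqEsubv subvf; apply/subvP => a _.
have -> : a = v (h a); last exact: subvsP.
pose vh : {lrmorphism A -> A} := v \o h.
transitivity (i a); first exact: (iuniq idfun).
apply/esym/(iuniq vh); first exact: (congr1 v hx).
exact: (congr1 v hy).
Qed.

(** The span is a subalgebra containing x and y: y moves past powers of x, and y^2 is a polynomial
    in x. *)
Lemma presented_span (A : falgType K) (x y : A) : presented_by zeta x y ->
  (<<[seq (x ^+ i * y ^+ j)%R | i <- iota 0 4, j <- iota 0 2]>> = fullv)%VS.
Proof.
move=> pres; have [rel _] := pres; have [x4 xy y2] := rel.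
set s := [seq _ | _ <- _, _ <- _]; set U := <<s>>%VS.
have monU i j : (j < 2)%N -> x ^+ i * y ^+ j \in U.
  move=> j2; rewrite -(expr_mod i x4); apply/memv_span/allpairsP.
  by exists ((i %% 4)%N, j); rewrite !mem_iota /= ltn_mod.
(* A product of two of the monomials contains y at most twice; the relation for y^2 handles j =
   2. *)
have monyU i j : (j < 3)%N -> x ^+ i * y ^+ j \in U.
  rewrite ltnS leq_eqVlt => /orP[/eqP->|]; last exact: monU.
  have xU k : x ^+ k \in U by have := monU k 0%N isT; rewrite mulr1.
  rewrite y2 -scalerAr !mulrDr mulrN -!scalerAr -!exprD -exprSr mulr1.
  by rewrite memvZ // !memvD ?memvN ?memvZ // xU.
have mulU : is_aspace U.
  rewrite /is_aspace has_algid1 /=; last by have := monU 0%N 0%N isT; rewrite mulr1.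
  apply/prodvP => u v uU vU.
  rewrite (coord_span (X := in_tuple s) uU) mulr_suml.
  apply: memv_suml => k _; rewrite -scalerAl memvZ //.
  have /allpairsP[[i j] [_ + ->]] : s`_k \in s by rewrite mem_nth.
  rewrite mem_iota /= => j2.
  rewrite (coord_span (X := in_tuple s) vU) mulr_sumr.
  apply: memv_suml => l _; rewrite -scalerAr memvZ //.
  have /allpairsP[[i' j'] [_ + ->]] : s`_l \in s by rewrite mem_nth.
  rewrite mem_iota /= => j'2.
  have [k' yx] : exists k', y ^+ j * x ^+ i' = x ^+ k' * y ^+ j.
    case: j j2 => [|[|]] // _; first by exists i'; rewrite mul1r mulr1.
    by exists (3 * i')%N; rewrite expr1 (relations_yx rel).
  rewrite /= -!mulrA (mulrA (y ^+ j)) yx -!mulrA -exprD mulrA -exprD.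
  apply: monyU; rewrite -addnS; exact: (leq_add j2 j'2).
apply: (presented_subalg (U := ASpace mulU) pres).
- by have := monU 0%N 0%N isT; rewrite mulr1.
- by have := monU 1%N 0%N isT; rewrite mulr1.
- by have := monU 0%N 1%N isT; rewrite mul1r.
Qed.

(** When x^2 = -1, the relations reduce to x y = - y x and y^2 = zeta. The diagonal matrix [X] and
    the antidiagonal matrix [Y] satisfy these. *)
Lemma presented_x2_neq1 (iota : K) (A : algType K) (x y : A) :
  2 != 0 :> K -> iota ^+ 2 = -1 -> presented_by zeta x y -> x ^+ 2 != 1.
Proof.
move=> two_neq0 iota2 [_ univ].
pose X : 'M[K]_2 := \matrix_(i, j)
  if i == j then (if i == 0 then iota else - iota) else 0.
pose Y : 'M[K]_2 := \matrix_(i, j)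
  if i == j then 0 else (if i == 0 then zeta else 1).
have X2 : X ^+ 2 = -1.
  apply/matrixP => i j; rewrite expr2 !mxE !big_ord_recl big_ord0 !mxE.
  by case: i j => [[|[|]] //= ?] [[|[|]] //= ?]; ring: iota2.
have XY : X * Y = - (Y * X).
  apply/matrixP => i j; rewrite !mxE !big_ord_recl !big_ord0 !mxE.
  by case: i j => [[|[|]] //= ?] [[|[|]] //= ?]; ring.
have Y2 : Y ^+ 2 = zeta *: 1.
  apply/matrixP => i j; rewrite expr2 !mxE !big_ord_recl !big_ord0 !mxE.
  by case: i j => [[|[|]] //= ?] [[|[|]] //= ?]; ring.
have X3 : X ^+ 3 = - X by rewrite exprS X2 mulrN1.
have rel : relations zeta X Y.
  split.
  - by rewrite -[4%N]/(2 * 2)%N exprM X2 sqrrN expr1n.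
  - by rewrite X3 mulrN.
  - rewrite X2 X3 Y2 scalerN opprK [_ + X + _]addrAC addrK -scalerDl scalerA.
    by congr (_ *: _); field.
have [f [fx _ _]] := univ _ _ _ rel.
apply/eqP => /(congr1 f); rewrite rmorphXn rmorph1 /= fx X2 => /matrixP/(_ 0 0).
rewrite !mxE /= => /eqP; rewrite eq_sym -subr_eq0 opprK.
by rewrite -[1 + 1]/2%:R (negbTE two_neq0).
Qed.

End Presentation.


(** * The group-like elements of the second family *)

Section SecondFamily.
Variables (K : fieldType) (iota zeta : K).
Hypotheses (two_neq0 : 2 != 0 :> K) (iota2 : iota ^+ 2 = -1).
Hypothesis zeta4 : zeta ^+ 4 = 1.
Variables (A : ydHopf K G) (x y : A).
Hypothesis gen : second_family_gen iota zeta x y.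

(** With a = iota zeta^2, the passage from x, x^3 to [omega2], [omega3] has determinant a, which is
    nonzero as a^2 = -1; so x and x^3 are recovered and all eight monomials are reached. *)
Lemma second_family_span :
  <<[:: 1; omega2 iota zeta x; omega3 iota zeta x; x ^+ 2;
        y; x ^+ 3 * y; x ^+ 2 * y; x * y]%R>>%VS = fullv.
Proof.
have [pres _ _ _] := gen; have [[x4 _ _] _] := pres.
apply/eqP; rewrite eqEsubv subvf -(presented_span pres).
set W := (X in (_ <= X)%VS); apply/span_subvP => _ /allpairsP[[i j] [ilt jlt ->]] /=.
have gW a : a \in [:: 1; omega2 iota zeta x; omega3 iota zeta x; x ^+ 2;
         y; x ^+ 3 * y; x ^+ 2 * y; x * y] -> a \in W by move=> /memv_span.
pose a := iota * zeta ^+ 2.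
have a2 : a ^+ 2 = -1 by rewrite exprMn iota2 -exprM zeta4 mulr1.
have omegaW c d : (2^-1 * c) *: omega2 iota zeta x +
    (2^-1 * d) *: omega3 iota zeta x \in W.
  by rewrite memvD // memvZ // gW // !inE eqxx ?orbT.
have omegaE c d : (2^-1 * c) *: omega2 iota zeta x +
    (2^-1 * d) *: omega3 iota zeta x =
    (2^-1 * 2^-1 * (c * (1 + a) + d * (1 - a))) *: x +
    (2^-1 * 2^-1 * (c * (1 - a) + d * (1 + a))) *: x ^+ 3.
  rewrite /omega2 /omega3 !scalerDr !scalerA addrACA -!scalerDl.
  by congr (_ *: _ + _ *: _); rewrite /a; ring.
(* As a^2 = -1, the inverse matrix is obtained by replacing a by -a; its rows supply the
   coefficients here and for x^3. *)
have xW : x \in W.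
  have := omegaW (1 - a) (1 + a); rewrite omegaE.
  rewrite (_ : _ * _ * _ = 1); last by field: a2.
  rewrite (_ : _ * _ * _ = 0); last by field: a2.
  by rewrite scale1r scale0r addr0.
have x3W : x ^+ 3 \in W.
  have := omegaW (1 + a) (1 - a); rewrite omegaE.
  rewrite (_ : _ * _ * _ = 0); last by field: a2.
  rewrite (_ : _ * _ * _ = 1); last by field: a2.
  by rewrite scale1r scale0r add0r.
move: ilt jlt; rewrite !inE /= => /or4P[]/eqP-> /orP[]/eqP->;
  rewrite ?expr0 ?expr1 ?mulr1 ?mul1r //; by rewrite gW // !inE eqxx ?orbT.
Qed.

(** By [grouplike_span] only the eight listed elements are possible, and [g3] fixes the four that
    are polynomials in x. *)
Lemma second_family_grouplike (a : A) :
  grouplike a -> Defs.act g3 a <> a -> exists i, a = x ^+ i * y.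
Proof.
have [_ [_ _ g3x _] _ gl] := gen.
move=> ga; have := grouplike_span gl ga.
rewrite second_family_span memvf => /(_ isT).
have fixp c d : Defs.act g3 (c *: x + d *: x ^+ 3) = c *: x + d *: x ^+ 3.
  by rewrite linearD !linearZ_LR /= act_exp g3x.
rewrite !inE => /or4P[|||/or4P[|||/orP[]]] /eqP -> //.
- by rewrite act_unit.
- by rewrite fixp.
- by rewrite fixp.
- by rewrite act_exp g3x.
- by move=> _; exists 0%N; rewrite mul1r.
- by exists 3%N.
- by exists 2%N.
- by exists 1%N; rewrite expr1.
Qed.

End SecondFamily.

(** * Comparison of the relations for y^2 along an isomorphism *)

Theorem theorem1p5 (K : closedFieldType) (charK : [pchar K] =i pred0)
    (iota : K) (iotaP : 4.-primitive_root iota)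
    (zeta xi : K) (zeta4 : zeta ^+ 4 = 1) (xi4 : xi ^+ 4 = 1)
    (zeta_neq_xi : zeta <> xi)
    (A_zeta A_xi : ydHopf K G)
    (A_zetaP : second_family iota zeta A_zeta)
    (A_xiP : second_family iota xi A_xi) :
  ~ ydHopf_isomorphic A_zeta A_xi.
Proof.
have two_neq0 : 2 != 0 :> K by have := charK 2; rewrite !inE /= => ->.
have iota2 : iota ^+ 2 = -1.
  have /eqP : (iota ^+ 2) ^+ 2 = 1 by rewrite -exprM (prim_expr_order iotaP).
  rewrite sqrf_eq1 => /orP[|/eqP//].
  by rewrite -(prim_order_dvd iotaP).
move=> [f [/bij_inj fI fcomul fcounit fact _]].
have [x [y genA]] := A_zetaP; have [x' [y' genB]] := A_xiP.
have [presA [g2x g2y g3x g3y] _ glA] := genA.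
have [presB [g2x' g2y' g3x' g3y'] _ glB] := genB.
have [[x4 xy y2] _] := presA; have [relB _] := presB.
have [x'4 x'y' y'2] := relB.
have gfy : grouplike (f y).
  by apply: grouplike_morph => //; apply: glA; rewrite !inE eqxx !orbT.
have [i fy] : exists i, f y = x' ^+ i * y'.
  apply: (second_family_grouplike two_neq0 iota2 xi4 genB gfy).
  (* If [g3] fixed [f y], injectivity would give x^2 y = y, hence x^2 = 1. *)
  rewrite -fact => /fI; rewrite g3y -[RHS]mul1r.
  move=> /(relations_y_cancel presA.1 two_neq0 zeta4) x21.
  by have := presented_x2_neq1 two_neq0 iota2 presA; rewrite x21 eqxx.
have relf := relations_morph f presA.1.
(* The pair [f x], [f y] satisfies the relations for zeta inside [A_xi], so [f y] can be cancelled
   there. *)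
have cancel := relations_y_cancel relf two_neq0 zeta4.
have fx2 : f x ^+ 2 = x' ^+ 2.
  apply: cancel; rewrite -(rmorphXn f) -(rmorphM f) -g3y /= fact fy.
  by rewrite act_mul act_exp g3x' g3y' mulrA -exprD [RHS]mulrA -exprD addnC.
(* Here [g2] sends [f y] = x'^i y' to x'^(3i+3) y' = x'^(2i+3) [f y]. *)
have fx3 : f x ^+ 3 = x' ^+ (2 * i + 3).
  apply: cancel; rewrite -(rmorphXn f) -(rmorphM f) -g2y /= fact fy.
  rewrite act_mul act_exp g2x' g2y' mulrA -exprM -exprD [RHS]mulrA -exprD.
  by congr (x' ^+ _ * _); lia.
have red m n : x' ^+ (4 * m + n) = x' ^+ n.
  by rewrite exprD exprM x'4 expr1n mul1r.
have fx : f x = x' ^+ (2 * i + 1).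
  have [fx4 _ _] := relf.
  (* [f x] is its own ninth power, the cube of [f x ^+ 3]; its exponent 6i + 9 is 2i + 1 modulo
     4. *)
  transitivity (f x ^+ (4 * 2 + 1)); first by rewrite exprD exprM fx4 expr1n mul1r.
  rewrite (exprM _ 3 3) fx3 -exprM -(red (i + 2)%N (2 * i + 1)%N).
  by congr (x' ^+ _); lia.
(* 2i + 1 and 2i + 3 are the two odd residues modulo 4; the parity of i only decides their order. *)
have fx13 : f x + f x ^+ 3 = x' + x' ^+ 3.
  rewrite fx3 fx -(odd_double_half i) -muln2; set h := i./2.
  case: (odd i) => /=.
    rewrite (_ : 2 * _ + 1 = 4 * h + 3)%N; last lia.
    by rewrite (_ : 2 * _ + 3 = 4 * (h + 1) + 1)%N ?red 1?addrC //; lia.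
  rewrite (_ : 2 * _ + 1 = 4 * h + 1)%N; last lia.
  by rewrite (_ : 2 * _ + 3 = 4 * h + 3)%N ?red //; lia.
have fy2 : f y ^+ 2 = y' ^+ 2.
  rewrite fy !expr2 -mulrA (mulrA y') (relations_yx relB).
  rewrite -!mulrA mulrA -exprD (_ : i + 3 * i = 4 * i + 0)%N; last lia.
  by rewrite red mul1r.
(* This isolates the term depending on zeta or xi; the summand u + u^3 is common to both sides and
   cancels. *)
have shape c (u : A_xi) : c *: 1 + u - c *: u ^+ 2 + u ^+ 3 =
    c *: (1 - u ^+ 2) + (u + u ^+ 3).
  by rewrite scalerBr -!addrA; congr (_ + _); rewrite addrCA.
have [_ _ /esym] := relf; rewrite fy2 y'2 !shape fx13 fx2.
have half_neq0 : 2^-1 != 0 :> K by rewrite invr_eq0.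
move=> /(scalerI half_neq0)/addIr/eqP; rewrite -subr_eq0 -scalerBl scaler_eq0.
rewrite !subr_eq0 => /orP[/eqP //|]; rewrite eq_sym.
by rewrite (negbTE (presented_x2_neq1 two_neq0 iota2 presB)).
Qed.
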